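(* Let $B$ be a self-adjoint operator in a separable complex Hilbert space $\mathfrak{H}$. Let $\omega:[0,\infty)\to\mathbb{R}$ satisfy: 1) $\omega$ is continuous and nondecreasing on $[0,\infty)$; 2) $\omega(0)=0$; 3) there exists $c>0$ such that $\omega(2t)\le c\,\omega(t)$ for all $t>0$; 4) $\int_0^1\frac{\omega(t)}{t}\,dt<\infty$. Let $G:\mathbb{R}\to[0,\infty)$ be even and nondecreasing on $[0,\infty)$, with $G(\lambda)>0$ for $\lambda>0$ and $\sup_{\lambda>0}\frac{G(2\lambda)}{G(\lambda)}<\infty$. If for $x\in\mathfrak{H}$ there exists $m>0$ such that $$\mathcal{E}_r(x,B)<\frac{m}{G(r)}\,\omega\left(\frac1r\right)\quad\text{for all } r>0,$$ then $x\in\mathcal{D}(G(B))$ and, for every $k\in\mathbb{N}=\{1,2,\dots\}$, there exists a constant $m_k>0$ such that $$\omega_k(t,G(B)x,B)\le m_k\left[t^k\int_t^1\frac{\omega(\tau)}{\tau^{k+1}}\,d\tau+\int_0^t\frac{\omega(\tau)}{\tau}\,d\tau\right],\quad 0<t\le\frac12.$$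
   Context: $B$ is a (possibly unbounded, densely defined) self-adjoint operator in $\mathfrak{H}$ with spectral measure $E(\cdot)$; $G(B)=\int_{-\infty}^{\infty}G(\lambda)\,dE(\lambda)$ with its natural domain $\mathcal{D}(G(B))$. Entire vectors of exponential type: $C^\infty(B)=\bigcap_{n\ge 0}\mathcal{D}(B^n)$; for $\alpha>0$, $\mathfrak{E}^{\alpha}(B)=\{x\in C^\infty(B):\exists c>0\ \forall k\in\{0,1,2,\dots\}\ \|B^kx\|\le c\alpha^k\}$; $\mathfrak{E}(B)=\bigcup_{\alpha>0}\mathfrak{E}^\alpha(B)$. The type of $x\in\mathfrak{E}(B)$ is $\sigma(x,B)=\inf\{\alpha>0: x\in\mathfrak{E}^\alpha(B)\}$. Best approximation: for $x\in\mathfrak{H}$ and $r>0$, $\mathcal{E}_r(x,B)=\inf\{\|x-y\|: y\in\mathfrak{E}(B),\ \sigma(y,B)\le r\}$ (equivalently $\|x-E([-r,r])x\|$). Modulus of continuity: with $U(h)=\exp(ihB)$ and $\Delta_h^k=(U(h)-\mathbb{I})^k$, $\omega_k(t,x,B)=\sup_{0<\tau\le t}\|\Delta_\tau^k x\|$ for $t>0$, $k\in\mathbb{N}$. *)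

(* Defs.v *)
From HB Require Import structures.
From mathcomp Require Import all_boot all_order all_algebra.
From mathcomp Require Import sesquilinear.
From mathcomp Require Import all_classical all_reals all_analysis.
From mathcomp Require Export complex.

Set Implicit Arguments.
Unset Strict Implicit.
Unset Printing Implicit Defensive.
Import Order.TTheory GRing.Theory Num.Theory.
Import numFieldNormedType.Exports.
Local Open Scope classical_set_scope.
Local Open Scope ring_scope.

(* The norm of a complex normed space is [R[i]]-valued; [hnorm] is the same
   number seen in [R]. *)
Definition hnorm (R : realType) (H : normedModType R[i]) (x : H) : R :=
  complex.Re `|x|.

Definition norm_of_inner_product (R : realType) (H : normedModType R[i])
    (ip : {dot H for Num.conj}) : Prop :=
  forall x : H, `|x| ^+ 2 = ip x x.

Definition separable (T : topologicalType) : Prop :=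
  exists2 D : set T, countable D & dense D.

(* Only the values of [app] on [dom] are meaningful. *)
Record operator (H : Type) := Operator { dom : set H ; app :> H -> H }.

Section Operators.
Variables (R : realType) (H : completeNormedModType R[i]).
Variable (ip : {dot H for Num.conj}).
Implicit Types (B T : operator H) (x y z : H).

Definition same_operator B T : Prop :=
  dom B = dom T /\ (forall x, dom B x -> B x = T x).

Definition linear_operator B : Prop :=
  dom B 0 /\
  (forall (a : R[i]) x y, dom B x -> dom B y ->
     dom B (a *: x + y) /\ B (a *: x + y) = a *: B x + B y).

(* [adjoint_graph B y z]: y belongs to the domain of the adjoint of B, which
   maps y to z. *)
Definition adjoint_graph B y z : Prop :=
  forall x, dom B x -> ip (B x) y = ip x z.

Definition self_adjoint B : Prop :=
  [/\ linear_operator B, dense (dom B) &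
      forall y z, adjoint_graph B y z <-> dom B y /\ z = B y].

Fixpoint dom_pow B (n : nat) : set H :=
  if n is m.+1 then [set x | dom_pow B m x /\ dom B (iter m B x)] else setT.

Definition smooth_vectors B : set H := \bigcap_n dom_pow B n.

Definition exp_vectors_le B (a : R) : set H :=
  [set x | smooth_vectors B x /\
     exists2 c : R, 0 < c & forall k : nat, hnorm (iter k B x) <= c * a ^+ k].

Definition exp_vectors B : set H :=
  \bigcup_(a in [set a : R | 0 < a]) exp_vectors_le B a.

Definition exp_type B x : R :=
  inf [set a : R | 0 < a /\ exp_vectors_le B a x].

(* The set contains |x| and is bounded below by 0, so the real [inf] is the
   actual infimum; likewise for [exp_type] on [exp_vectors B]. *)
Definition best_approx B (r : R) x : R :=
  inf [set hnorm (x - y) | y in [set y | exp_vectors B y /\ exp_type B y <= r]].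

Definition orthogonal_projection (P : H -> H) : Prop :=
  [/\ linear P, (forall x, P (P x) = P x) & forall x y, ip (P x) y = ip x (P y)].

Record projection_valued_measure (E : set (measurableTypeR R) -> H -> H) : Prop := {
  pvm_proj : forall A, measurable A -> orthogonal_projection (E A) ;
  pvm_setT : forall x, E setT x = x ;
  pvm_sigma_additive : forall F : (set (measurableTypeR R))^nat,
    (forall n, measurable (F n)) -> trivIset setT F ->
    forall x, (fun n => \sum_(i < n) E (F i) x) @ \oo --> E (\bigcup_n F n) x
}.

Variable E : set (measurableTypeR R) -> H -> H.

(* The measure [A |-> <E(A) x, x>], whose values are real. *)
Definition scalar_measure x (A : set (measurableTypeR R)) : \bar R :=
  (complex.Re (ip (E A x) x))%:E.

Definition sqr_integral x (f : measurableTypeR R -> R[i]) : \bar R :=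
  (\int[scalar_measure x]_l ((complex.Re `|f l|) ^+ 2)%:E)%E.

Definition simple_integral (s : {fimfun measurableTypeR R >-> R[i]}) x : H :=
  \sum_(c \in range s) c *: E (s @^-1` [set c]) x.

Definition measurable_simple (s : {fimfun measurableTypeR R >-> R[i]}) : Prop :=
  forall c, measurable (s @^-1` [set c]).

(* z is the integral of f against the vector measure [E(.) x]: the limit of
   the integrals of simple Borel functions converging to f in the L^2 space of
   [scalar_measure x]. *)
Definition is_spectral_integral (f : measurableTypeR R -> R[i]) x z : Prop :=
  exists s : nat -> {fimfun measurableTypeR R >-> R[i]},
    [/\ forall n, measurable_simple (s n),
        (fun n => sqr_integral x (fun l => f l - s n l)) @ \oo --> 0%E &
        (fun n => simple_integral (s n) x) @ \oo --> z].

(* For Borel f. The integral exists and is unique on this domain, by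
   completeness, so that [xget] selects a well-defined vector there. *)
Definition spectral_integral (f : R -> R[i]) : operator H :=
  Operator [set x | (sqr_integral x f < +oo)%E]
           (fun x => xget 0 (is_spectral_integral f x)).

Definition spectral_measure_of B : Prop :=
  projection_valued_measure E /\
  same_operator B (spectral_integral (fun l => l%:C%C)).

Definition real_function_of (G : R -> R) : operator H :=
  spectral_integral (fun l => (G l)%:C%C).

(* exp(ihB), with exp(i h l) = cos(h l) + i sin(h l). *)
Definition unitary_group (h : R) : operator H :=
  spectral_integral (fun l => (cos (h * l) +i* sin (h * l))%C).

Definition difference (h : R) (k : nat) x : H :=
  iter k (fun y => unitary_group h y - y) x.

(* The set is bounded by 2^k |x|, so the real [sup] is the actual supremum. *)
Definition modulus (k : nat) (t : R) x : R :=
  sup [set hnorm (difference tau k x) | tau in [set tau : R | 0 < tau <= t]].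

End Operators.

(* Main.v *)
(* The measure A |-> |E(A)x|^2 controls everything.  If z is the integral of f
   against E(.)x, then |E(A)z|^2 is the integral over A of |f|^2 against this
   measure; so two-sided bounds of |f| on A turn into bounds of |E(A)z| by
   |E(A)x|.  Applied to the powers of B on {|l| >= b}, this shows that E({|l| >= b})
   kills every vector of exponential type r < b, hence that |E({|l| >= b})x| is at
   most the best approximation of x of order r.

   Cut the line into the shells S_0 = {|l| < 2} and
   S_(n+1) = {2^(n+1) <= |l| < 2^(n+2)}.  With r = 2^n, the hypothesis and the
   doubling of G bound |E(S_(n+1))G(B)x| by a multiple of omega(2^-n), while
   |exp(i tau l) - 1| <= min(2, tau |l|) bounds the effect of the k-th difference
   on each shell.  Summing over the shells, the terms with t <= 2^-(n+1) are
   compared with the integral over [t, 1] and the others with the one over ]0, t]. *)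
From HB Require Import structures.
From mathcomp Require Import all_boot all_order all_algebra.
From mathcomp Require Import sesquilinear finmap.
From mathcomp Require Import all_classical all_reals all_analysis.
From mathcomp Require Import measurable_realfun ring lra.
Require Import Defs.
Set Implicit Arguments.
Unset Strict Implicit.
Unset Printing Implicit Defensive.
Import Order.TTheory GRing.Theory Num.Theory.
Import numFieldNormedType.Exports HBNNSimple.
Local Open Scope classical_set_scope.
Local Open Scope ring_scope.

(** * The real-valued norm: convergence and completeness *)

Section HilbertNorm.
Variables (R : realType) (H : completeNormedModType R[i]).
Implicit Types (x y z : H) (u : nat -> H).

Lemma normE_hnorm x : `|x| = (hnorm x)%:C%C.
Proof.
have := normr_ge0 x; rewrite lecE /= => /andP[/eqP im0 _].
by rewrite /hnorm [LHS]complexE im0 mulr0 addr0.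
Qed.

Lemma hnorm_ge0 x : 0 <= hnorm x.
Proof. by rewrite -ler0c -normE_hnorm. Qed.

Lemma hnorm0 : hnorm (0 : H) = 0.
Proof. by rewrite /hnorm normr0. Qed.

Lemma hnorm_eq0 x : hnorm x = 0 -> x = 0.
Proof. by move=> x0; apply/normr0_eq0; rewrite normE_hnorm x0. Qed.

Lemma hnormD x y : hnorm (x + y) <= hnorm x + hnorm y.
Proof.
have := ler_normD x y.
by rewrite !normE_hnorm -raddfD /= lecR.
Qed.

Lemma hnormBC x y : hnorm (x - y) = hnorm (y - x).
Proof. by rewrite /hnorm distrC. Qed.

Lemma hnorm_sum u n : hnorm (\sum_(i < n) u i) <= \sum_(i < n) hnorm (u i).
Proof.
elim: n => [|n ih]; first by rewrite !big_ord0 hnorm0.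
rewrite !big_ord_recr /=; apply: le_trans (hnormD _ _) _.
by rewrite lerD2r.
Qed.

Lemma hnormZ (a : R[i]) x : hnorm (a *: x) = complex.Re `|a| * hnorm x.
Proof.
rewrite {1}/hnorm normrZ normE_hnorm.
by case: `|a| => p q /=; rewrite mulr0 subr0.
Qed.

Lemma ler_dist_hnorm x y : `|hnorm x - hnorm y| <= hnorm (x - y).
Proof.
rewrite ler_norml; apply/andP; split.
  have := hnormD (y - x) x; rewrite subrK hnormBC; lra.
have := hnormD (x - y) y; rewrite subrK; lra.
Qed.

(** A positive element of [R[i]] has zero imaginary part, so the radii that define the topology of
    [H] are exactly the positive reals. *)
Lemma hnorm_cvgP u x : (u @ \oo --> x) <->
  (fun n => hnorm (x - u n)) @ \oo --> (0 : R).
Proof.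
split.
  move=> /cvgrPdist_lt ux; apply/cvgrPdist_lt => e e0.
  have e0' : 0 < e%:C%C :> R[i] by rewrite ltcR.
  have := ux _ e0'; apply: filterS => n.
  by rewrite normE_hnorm ltcR sub0r normrN (ger0_norm (hnorm_ge0 _)).
move=> /cvgrPdist_lt ux; apply/cvgrPdist_lt => e; rewrite ltcE /= => /andP[/eqP ei e0].
have := ux _ e0; apply: filterS => n.
rewrite sub0r normrN (ger0_norm (hnorm_ge0 _)) normE_hnorm => h.
by rewrite ltcE /= ei eqxx.
Qed.

Lemma cvg_hnorm u x : u @ \oo --> x -> (fun n => hnorm (u n)) @ \oo --> hnorm x.
Proof.
move=> /hnorm_cvgP/cvgrPdist_lt ux; apply/cvgrPdist_lt => e /ux.
apply: filterS => n; rewrite sub0r normrN (ger0_norm (hnorm_ge0 _)).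
exact/le_lt_trans/ler_dist_hnorm.
Qed.

Lemma hnorm_cauchy_cvg u :
  (forall e : R, 0 < e -> exists N, forall n m, (N <= n)%N -> (N <= m)%N ->
     hnorm (u n - u m) < e) -> exists x, u @ \oo --> x.
Proof.
move=> cu; apply/cvg_ex; apply: cauchy_cvg; apply: cauchy_exP => e.
rewrite ltcE /= => /andP[/eqP ei /cu[N uN]].
exists (u N); exists N => //= n /= Nn.
rewrite -ball_normE /ball_ /= normE_hnorm ltcE /= ei eqxx /=.
exact: uN.
Qed.

Lemma Re_sqr_norm (z : R[i]) :
  complex.Re `|z| ^+ 2 = complex.Re z ^+ 2 + complex.Im z ^+ 2.
Proof. by rewrite normc_def /= sqr_sqrtr // addr_ge0 // sqr_ge0. Qed.

Lemma Re_norm_ge0 (z : R[i]) : 0 <= complex.Re `|z|.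
Proof. by rewrite normc_def /= sqrtr_ge0. Qed.

End HilbertNorm.

(** * Projection-valued measures *)

Section ProjectionValuedMeasure.
Variables (R : realType) (H : completeNormedModType R[i]).
Variables (ip : {dot H for Num.conj}) (Hip : norm_of_inner_product ip).
Variable E : set (measurableTypeR R) -> H -> H.
Hypothesis HE : projection_valued_measure ip E.
Implicit Types (A D : set (measurableTypeR R)) (x y z w : H).

Lemma sqr_hnorm x : hnorm x ^+ 2 = complex.Re (ip x x).
Proof. by rewrite -Hip normE_hnorm -rmorphXn /=. Qed.

Lemma Re_ip_suml (u : nat -> H) n x :
  complex.Re (ip (\sum_(i < n) u i) x) = \sum_(i < n) complex.Re (ip (u i) x).
Proof.
elim: n => [|n ih]; first by rewrite !big_ord0 linear0l.
by rewrite !big_ord_recr /= linearDl raddfD /= ih.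
Qed.

Lemma pvmZ A (a : R[i]) x : measurable A -> E A (a *: x) = a *: E A x.
Proof.
move=> /(pvm_proj HE)[lE _ _].
have E0 : E A 0 = 0 by have := lE (-1) 0 0; rewrite scaler0 add0r scaleN1r addNr.
by have := lE a x 0; rewrite addr0 E0 addr0.
Qed.

Lemma pvmD A x y : measurable A -> E A (x + y) = E A x + E A y.
Proof. by move=> /(pvm_proj HE)[lE _ _]; have := lE 1 x y; rewrite !scale1r. Qed.

Lemma pvmv0 A : measurable A -> E A 0 = 0.
Proof. by move=> mA; have := pvmZ 0 0 mA; rewrite !scale0r. Qed.

Lemma pvmN A x : measurable A -> E A (- x) = - E A x.
Proof. by move=> mA; rewrite -scaleN1r pvmZ// scaleN1r. Qed.

Lemma pvmB A x y : measurable A -> E A (x - y) = E A x - E A y.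
Proof. by move=> mA; rewrite pvmD// pvmN. Qed.

Lemma pvm_id A x : measurable A -> E A (E A x) = E A x.
Proof. by move=> /(pvm_proj HE)[_ idE _]; exact: idE. Qed.

Lemma Re_ip_pvm A x : measurable A -> complex.Re (ip (E A x) x) = hnorm (E A x) ^+ 2.
Proof.
move=> mA; rewrite sqr_hnorm; have [_ idE sE] := pvm_proj HE mA.
by rewrite -[X in _ = complex.Re (_ _ X)]/(E A x) -sE idE.
Qed.

(** For the constant sequence of empty sets the partial sums converge, and consecutive ones differ
    by [E set0 x], which is therefore 0. *)
Lemma pvm_set0 x : E set0 x = 0.
Proof.
have h : trivIset [set: nat] (fun _ : nat => set0 : set (measurableTypeR R)).
  by move=> i j _ _ [? []].
have := @pvm_sigma_additive _ _ _ _ HE (fun _ => set0) (fun _ => measurable0) h x.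
rewrite bigcup0// => cv.
have c1 : (fun n => \sum_(i < n.+1) E set0 x) @ \oo --> E set0 x.
  by have := cv; rewrite -(cvg_shiftS (fun n => \sum_(i < n) E set0 x)).
have c0 : (fun _ : nat => E set0 x) @ \oo --> E set0 x - E set0 x.
  have -> : (fun _ : nat => E set0 x) =
      (fun n => \sum_(i < n.+1) E set0 x) - (fun n => \sum_(i < n) E set0 x).
    by apply/funext => n; rewrite fctE big_ord_recr /= addrAC subrr add0r.
  exact: (cvgB c1 cv).
rewrite subrr in c0.
have c1' : (fun _ : nat => E set0 x) @ \oo --> E set0 x by exact: cvg_cst.
exact: (cvg_unique (@norm_hausdorff _ _) c1' c0).
Qed.

Lemma pvm_bigcup (F : nat -> set (measurableTypeR R)) x :
  (forall n, measurable (F n)) -> trivIset setT F ->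
  (fun n => \sum_(i < n) E (F i) x) @ \oo --> E (\bigcup_n F n) x.
Proof. by move=> mF tF; exact: (pvm_sigma_additive HE mF tF). Qed.

Lemma pvmU A D x : measurable A -> measurable D -> A `&` D = set0 ->
  E (A `|` D) x = E A x + E D x.
Proof.
move=> mA mD AD.
have mF n : measurable (bigcup2 A D n) by case: n => [|[|n]] //=.
have := @pvm_bigcup (bigcup2 A D) x mF.
rewrite bigcup2E.
have tF : trivIset setT (bigcup2 A D).
  by rewrite -trivIset_bigcup2.
move=> /(_ tF) cv.
suff cv' : (fun n => \sum_(i < n) E (bigcup2 A D i) x) @ \oo --> E A x + E D x.
  exact: (cvg_unique (@norm_hausdorff _ _) cv cv').
apply: cvg_near_cst; exists 2 => //= -[|[|n]] //= _.
rewrite !big_ord_recl /= big1 ?addr0//= => i _.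
by rewrite pvm_set0.
Qed.

(** [|E(A)x|^2] is the real part of [<E(A)x, x>], which is additive in [A]. This gives Pythagoras
    before the ranges are known to be orthogonal. *)
Lemma sqr_hnorm_pvmU A D x : measurable A -> measurable D -> A `&` D = set0 ->
  hnorm (E (A `|` D) x) ^+ 2 = hnorm (E A x) ^+ 2 + hnorm (E D x) ^+ 2.
Proof.
move=> mA mD AD; have mAD := measurableU _ _ mA mD.
by rewrite -!Re_ip_pvm// pvmU// linearDl raddfD.
Qed.

Lemma hnorm_pvm_le A x : measurable A -> hnorm (E A x) <= hnorm x.
Proof.
move=> mA; rewrite -ler_sqr ?nnegrE ?hnorm_ge0//.
rewrite -[X in _ <= hnorm X ^+ 2](pvm_setT HE) -(setvU A) setUC.
by rewrite sqr_hnorm_pvmU ?setICr ?lerDl ?sqr_ge0//; exact: measurableC.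
Qed.

(* For x = E(D)y, Pythagoras gives
   |E(A)x|^2 + |E(D)x|^2 = |E(A `|` D)x|^2 <= |x|^2 = |E(D)x|^2. *)
Lemma pvm_disjoint A D x : measurable A -> measurable D -> A `&` D = set0 ->
  E A (E D x) = 0.
Proof.
move=> mA mD AD; apply: hnorm_eq0; apply/eqP; rewrite -sqrf_eq0 eq_le sqr_ge0 andbT.
have := hnorm_pvm_le (E D x) (measurableU _ _ mA mD).
rewrite -ler_sqr ?nnegrE ?hnorm_ge0// sqr_hnorm_pvmU// (pvm_id x mD).
by rewrite gerDr.
Qed.

(** Splitting [A] and [D] along their intersection leaves remainders disjoint from the other sets
    involved, so the corresponding products of projections vanish. *)
Lemma pvmI A D x : measurable A -> measurable D -> E A (E D x) = E (A `&` D) x.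
Proof.
move=> mA mD; have mAD := measurableI _ _ mA mD.
have mA' := measurableD mA mD; have mD' := measurableD mD mA.
have dA : (A `&` D) `&` (A `\` D) = set0 by rewrite -setIA setDIK// setI0.
have dD : (A `&` D) `&` (D `\` A) = set0 by rewrite [A `&` D]setIC -setIA setDIK setI0.
have EA := pvmU (E D x) mAD mA' dA; rewrite setUIDK in EA.
have ED := pvmU x mAD mD' dD; rewrite [A `&` D]setIC setUIDK [D `&` A]setIC in ED.
rewrite EA (@pvm_disjoint (A `\` D) D)//; last by rewrite setIC setDIK.
by rewrite addr0 ED pvmD// pvm_id// pvm_disjoint ?addr0.
Qed.

Lemma pvm_bigsetU (F : nat -> set (measurableTypeR R)) x n :
  (forall n, measurable (F n)) -> trivIset setT F ->
  E (\big[setU/set0]_(i < n) F i) x = \sum_(i < n) E (F i) x.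
Proof.
move=> mF tF; elim: n => [|n ih]; first by rewrite !big_ord0 pvm_set0.
rewrite !big_ord_recr /= pvmU ?ih//; first exact: bigsetU_measurable.
by apply: (@trivIset_bigsetUI _ xpredT F) => // i j _ _; exact: tF.
Qed.

(* Agrees with [scalar_measure] on measurable sets, but is nonnegative on all
   sets, as the structure of measure requires. *)
Definition pvm_mass of projection_valued_measure ip E & norm_of_inner_product ip :=
  fun x A => (hnorm (E A x) ^+ 2)%:E.

Let mass x := pvm_mass HE Hip x.

Let mass0 x : mass x set0 = 0%E.
Proof. by rewrite /mass /pvm_mass pvm_set0 hnorm0 expr0n. Qed.

Let mass_ge0 x A : (0 <= mass x A)%E.
Proof. by rewrite /mass /pvm_mass lee_fin sqr_ge0. Qed.

Let mass_sigma_additive x : semi_sigma_additive (mass x).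
Proof.
move=> F mF tF _; rewrite /mass /pvm_mass.
(* The masses add up to the squared norm of the vector partial sum, so countable additivity follows
   from convergence in [H] and continuity of the norm. *)
have -> : (fun n => \sum_(0 <= i < n) (hnorm (E (F i) x) ^+ 2)%:E)%E =
    (fun n => (hnorm (\sum_(i < n) E (F i) x) ^+ 2)%:E).
  apply/funext => n; rewrite sumEFin big_mkord; congr EFin.
  rewrite -pvm_bigsetU// -Re_ip_pvm; last exact: bigsetU_measurable.
  rewrite pvm_bigsetU// (Re_ip_suml (fun i => E (F i) x)).
  by apply: eq_bigr => i _; rewrite Re_ip_pvm.
apply: cvg_EFin; first by near=> n.
have c := cvg_hnorm (@pvm_bigcup F x mF tF).
by rewrite expr2; under eq_fun do rewrite /= expr2; exact: (cvgM c c).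
Unshelve. all: by end_near. Qed.

HB.instance Definition _ x := isMeasure.Build _ _ _ (pvm_mass HE Hip x)
  (mass0 x) (mass_ge0 x) (@mass_sigma_additive x).

Lemma pvm_mass_setT x : pvm_mass HE Hip x setT = (hnorm x ^+ 2)%:E.
Proof. by rewrite /pvm_mass (pvm_setT HE). Qed.

Lemma scalar_measureE x A : measurable A -> scalar_measure ip E x A = pvm_mass HE Hip x A.
Proof. by move=> mA; rewrite /scalar_measure Re_ip_pvm. Qed.

End ProjectionValuedMeasure.

(** * Integrals of simple functions *)

Section FiniteRange.
Context d (T : measurableType d) (V : choiceType) (p : T -> V).
Hypotheses (fp : finite_set (range p)) (mp : forall v, measurable (p @^-1` [set v])).

Lemma finite_range_measurable (Y : set V) : measurable (p @^-1` Y).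
Proof.
have -> : p @^-1` Y = \bigcup_(v in range p `&` Y) p @^-1` [set v].
  apply/seteqP; split => [t /= Yt|t [v [_ Yv] /= ->]] //.
  by exists (p t) => //; split => //; exists t.
apply: fin_bigcup_measurable => //; exact: finite_setIl.
Qed.

Lemma finite_range_measurable_fun d' (T' : measurableType d') (g : V -> T') :
  measurable_fun setT (g \o p).
Proof.
move=> _ Y mY; rewrite setTI comp_preimage; exact: finite_range_measurable.
Qed.

Lemma finite_range_seq : exists2 s : seq V, uniq s & forall t, p t \in s.
Proof.
have /finite_seqP[s sE] := fp; exists (undup s); first exact: undup_uniq.
move=> t; rewrite mem_undup.
by have : [set` s] (p t) by rewrite -sE; exists t.
Qed.

Lemma finite_range_integral (R : realType) (mu : {measure set T -> \bar R})
    (s : seq V) (A : set T) (f : T -> \bar R) :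
  uniq s -> (forall t, p t \in s) -> measurable A ->
  measurable_fun A f -> (forall t, A t -> 0 <= f t)%E ->
  (\int[mu]_(t in A) f t = \sum_(v <- s) \int[mu]_(t in A `&` p @^-1` [set v]) f t)%E.
Proof.
move=> us ps mA mf f0.
have AE : \big[setU/set0]_(v <- s) (A `&` p @^-1` [set v]) = A.
  apply/seteqP; split => [t|t At].
    by rewrite -bigcup_seq => -[v _ []].
  by rewrite -bigcup_seq; exists (p t) => //=; exact: ps.
rewrite -[in LHS]AE ge0_integral_bigsetU ?AE//.
- by move=> v; exact: measurableI.
- by move=> u v _ _ [t [[_ /= <-] [_ /= <-]]].
Qed.

End FiniteRange.

Section ComplexValued.
Context d (T : measurableType d) (R : realType).
Implicit Types (f g h : T -> R[i]) (a b c : R[i]) (A : set T).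

(** Borel measurability in real coordinates, the form in which [|f|^2 = Re^2 + Im^2] is seen to be
    measurable. *)
Definition cmeasurable f :=
  measurable_fun setT (fun t => complex.Re (f t)) /\
  measurable_fun setT (fun t => complex.Im (f t)).

Lemma cmeasurable_cst a : cmeasurable (fun=> a).
Proof. by split; exact: measurable_cst. Qed.

Lemma cmeasurableB f g : cmeasurable f -> cmeasurable g ->
  cmeasurable (fun t => f t - g t).
Proof.
move=> [f1 f2] [g1 g2]; split.
- by under eq_fun do rewrite raddfB /=; exact: measurable_funB.
- by under eq_fun do rewrite raddfB /=; exact: measurable_funB.
Qed.

Lemma cmeasurable_sqr_norm f A : cmeasurable f ->
  measurable_fun A (fun t => (complex.Re `|f t| ^+ 2)%:E).
Proof.
move=> [f1 f2]; apply: (measurable_funS measurableT) => //.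
apply/measurable_EFinP; under eq_fun do rewrite Re_sqr_norm.
by apply: measurable_funD; exact: measurable_funX.
Qed.

(** Young's inequality: the two sides differ by [e] times the square of [u - v/e]. *)
Lemma sqrD_le (e u v : R) : 0 < e ->
  (u + v) ^+ 2 <= (1 + e) * u ^+ 2 + (1 + e^-1) * v ^+ 2.
Proof.
move=> e0; rewrite -subr_ge0.
have -> : (1 + e) * u ^+ 2 + (1 + e^-1) * v ^+ 2 - (u + v) ^+ 2 =
    e * (u - e^-1 * v) ^+ 2 by field; rewrite gt_eqF.
by rewrite mulr_ge0 ?sqr_ge0// ltW.
Qed.

Lemma sqr_normB_le (e : R) a b c : 0 < e ->
  complex.Re `|a - b| ^+ 2 <=
  (1 + e) * complex.Re `|a - c| ^+ 2 + (1 + e^-1) * complex.Re `|c - b| ^+ 2.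
Proof.
move=> e0; have -> : a - b = (a - c) + (c - b) by rewrite addrA subrK.
move: (a - c) (c - b) => u v; rewrite !Re_sqr_norm !raddfD /=.
rewrite !mulrDr addrACA; apply: lerD; exact: sqrD_le.
Qed.

Lemma le_perturb (u v : R) : 0 <= v ->
  (forall e, 0 < e -> u <= (1 + e) * (v + e) + e) -> u <= v.
Proof.
move=> v0 uv; apply/ler_addgt0Pr => e e0.
have v3 : 0 < v + 3 by lra.
(* [(1 + m)(v + m) + m = v + m(v + 2 + m)] is at most [v + m(v + 3)] for [m <= 1]; hence the cap 1
   and the denominator [v + 3]. *)
have e1 : 0 < Num.min 1 (e / (v + 3)) by rewrite lt_min ltr01 divr_gt0.
apply: le_trans (uv _ e1) _.
set m := Num.min _ _ in e1 *.
have m1 : m <= 1 by rewrite ge_min lexx.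
have m2 : m * (v + 3) <= e by rewrite -ler_pdivlMr// ge_min lexx orbT.
nra.
Qed.

End ComplexValued.

Section SpectralIntegral.
Variables (R : realType) (H : completeNormedModType R[i]).
Variables (ip : {dot H for Num.conj}) (Hip : norm_of_inner_product ip).
Variable E : set (measurableTypeR R) -> H -> H.
Hypothesis HE : projection_valued_measure ip E.
Implicit Types (A D : set (measurableTypeR R)) (x y z w : H).
Implicit Types (f g : measurableTypeR R -> R[i]).

Local Notation mu := (pvm_mass HE Hip).

(** An integral is built from suprema over simple functions, which evaluate the set function on
    measurable sets only, where the two agree. *)
Lemma sqr_integralE x f :
  sqr_integral ip E x f = (\int[mu x]_l (complex.Re `|f l| ^+ 2)%:E)%E.
Proof.
rewrite /sqr_integral /integral /=.
have S (h : {nnsfun measurableTypeR R >-> R}) :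
    sintegral (scalar_measure ip E x) h = sintegral (mu x) h.
  apply: eq_fsbigr => r _; congr (_ * _)%E.
  by rewrite (scalar_measureE Hip HE)//; exact: measurable_sfunP.
congr (_ - _)%E; congr ereal_sup; apply/seteqP; split=> _ /= [h fh <-];
  by exists h => //; rewrite ?S// -S.
Qed.

(** On the fibre over [v] the vector [w] acts as [g v] times [x], so its mass there is [|g v|^2]
    times that of [x]; summing over fibres gives the integral. The type [V] is arbitrary so that [p]
    can be one simple function or a pair of them. *)
Lemma pvm_mass_finite_range (V : choiceType) (p : measurableTypeR R -> V)
    (g : V -> R[i]) x w A :
  finite_set (range p) -> (forall v, measurable (p @^-1` [set v])) ->
  (forall v, E (p @^-1` [set v]) w = g v *: E (p @^-1` [set v]) x) ->
  measurable A ->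
  mu w A = (\int[mu x]_(l in A) (complex.Re `|g (p l)| ^+ 2)%:E)%E.
Proof.
move=> fp mp wx mA; have [s us ps] := finite_range_seq fp.
rewrite -[LHS]mul1e -integral_cst//.
rewrite (finite_range_integral mp _ us ps)// [RHS](finite_range_integral mp _ us ps)//; last first.
- by move=> l _; rewrite lee_fin sqr_ge0.
- apply: (measurable_funS measurableT) => //; apply/measurable_EFinP.
  exact: (finite_range_measurable_fun fp mp (fun v => complex.Re `|g v| ^+ 2)).
apply: eq_bigr => v _; have mAv := measurableI _ _ mA (mp v).
rewrite integral_cst// mul1e.
rewrite (eq_integral (cst (complex.Re `|g v| ^+ 2)%:E)); last first.
  by move=> l; rewrite inE => -[_ /= ->].
rewrite integral_cst// -[LHS]/((hnorm (E (A `&` p @^-1` [set v]) w) ^+ 2)%:E).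
rewrite -(pvmI Hip HE)// wx (pvmZ HE)// (pvmI Hip HE)// hnormZ exprMn.
by rewrite EFinM.
Qed.

Lemma simple_integral_fiber (s : {fimfun measurableTypeR R >-> R[i]}) x v : measurable_simple s ->
  E (s @^-1` [set v]) (simple_integral E s x) = v *: E (s @^-1` [set v]) x.
Proof.
move=> ms; have mv : measurable (s @^-1` [set v]) by exact: ms.
rewrite /simple_integral fsbig_finite//=.
rewrite (big_morph (E (s @^-1` [set v])) (fun y z => pvmD HE y z mv) (pvmv0 HE mv)).
have term c : E (s @^-1` [set v]) (c *: E (s @^-1` [set c]) x) =
    if c == v then v *: E (s @^-1` [set v]) x else 0.
  rewrite (pvmZ HE)//; case: eqVneq => [->|cv]; first by rewrite (pvm_id HE).
  have mc : measurable (s @^-1` [set c]) := ms c.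
  rewrite (pvm_disjoint Hip HE) ?scaler0//.
  by apply/seteqP; split => // l [/= -> vc]; move: cv; rewrite vc eqxx.
under eq_bigr do rewrite term.
have [vs|vs] := boolP (v \in fset_set (range s)).
  by rewrite (bigD1_seq v vs (fset_uniq _)) eqxx big1 /= => [|c /negPf -> //]; rewrite addr0.
(* A value that is not attained has an empty fibre, and both sides vanish. *)
rewrite big_seq big1.
  suff -> : s @^-1` [set v] = set0 by rewrite (pvm_set0 HE) scaler0.
  apply/seteqP; split => // l /= lv; move: vs; rewrite in_fset_set//.
  by rewrite notin_setE; apply; exists l.
by move=> c cs; case: eqVneq => // cv; move: vs; rewrite -cv cs.
Qed.

Lemma measurable_simple_cmeasurable (s : {fimfun measurableTypeR R >-> R[i]}) :
  measurable_simple s -> cmeasurable s.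
Proof.
move=> ms; have fs : finite_set (range s) by exact: fimfunP.
by split; apply: (finite_range_measurable_fun fs ms).
Qed.

Lemma simple_integralB_mass (s : {fimfun measurableTypeR R >-> R[i]}) x (d : R[i]) A :
  measurable_simple s -> measurable A ->
  mu (simple_integral E s x - d *: x) A =
  (\int[mu x]_(l in A) (complex.Re `|s l - d| ^+ 2)%:E)%E.
Proof.
move=> ms mA.
apply: (@pvm_mass_finite_range _ s (fun c => c - d)) => // v.
by rewrite (pvmB HE)// (pvmZ HE)// simple_integral_fiber// scalerBl.
Qed.

(** The isometry of L^2 into [H] on simple functions. The fibres of the pair [(s, s')] form a common
    refinement, and projecting onto one of them turns both integrals into multiples of the same
    vector. *)
Lemma simple_integral_dist (s s' : {fimfun measurableTypeR R >-> R[i]}) x :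
  measurable_simple s -> measurable_simple s' ->
  (hnorm (simple_integral E s x - simple_integral E s' x) ^+ 2)%:E =
  (\int[mu x]_l (complex.Re `|s l - s' l| ^+ 2)%:E)%E.
Proof.
move=> ms ms'; rewrite -(pvm_mass_setT Hip HE).
have pE v : (fun l => (s l, s' l)) @^-1` [set v] =
    (s @^-1` [set v.1]) `&` (s' @^-1` [set v.2]).
  by case: v => c c'; apply/seteqP; split => l /= [-> ->].
apply: (@pvm_mass_finite_range _ (fun l => (s l, s' l)) (fun c => c.1 - c.2)) => //.
- apply: (@sub_finite_set _ _ (range s `*` range s')).
    by move=> _ [l _ <-]; split; exists l.
  by apply: finite_setX.
- by move=> v; rewrite pE; apply: measurableI; [exact: ms|exact: ms'].
move=> v; have m1 := ms v.1; have m2 := ms' v.2.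
rewrite pE (pvmB HE); last exact: measurableI.
rewrite {1}setIC -!(pvmI Hip HE)// !simple_integral_fiber// !(pvmZ HE)//.
by rewrite !(pvmI Hip HE)// [X in E X]setIC scalerBl.
Qed.

End SpectralIntegral.

(** * Spectral integrals *)

Section L2.
Context d (T : measurableType d) (R : realType) (mu : {measure set T -> \bar R}).
Implicit Types (f g h : T -> R[i]) (A : set T).
Local Open Scope ereal_scope.

Definition sqr_dist A f g := \int[mu]_(t in A) (complex.Re `|f t - g t| ^+ 2)%:E.

Lemma sqr_dist_ge0 A f g : 0 <= sqr_dist A f g.
Proof. by apply: integral_ge0 => t _; rewrite lee_fin sqr_ge0. Qed.

Lemma sqr_distC A f g : sqr_dist A f g = sqr_dist A g f.
Proof. by apply: eq_integral => t _; rewrite distrC. Qed.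

Lemma sqr_dist_setT A f g : cmeasurable f -> cmeasurable g -> measurable A ->
  sqr_dist A f g <= sqr_dist setT f g.
Proof.
move=> mf mg mA; apply: ge0_subset_integral => //.
- exact: cmeasurable_sqr_norm (cmeasurableB mf mg).
- by move=> t _; rewrite lee_fin sqr_ge0.
Qed.

(** The integrated Young inequality; its free weight [e] lets it do the work of Minkowski's
    inequality in passages to the limit. *)
Lemma sqr_dist_le (e : R) A f g h : (0 < e)%R ->
  cmeasurable f -> cmeasurable g -> cmeasurable h -> measurable A ->
  sqr_dist A f g <= (1 + e)%:E * sqr_dist A f h + (1 + e^-1)%:E * sqr_dist A h g.
Proof.
move=> e0 mf mg mh mA.
have m1 := @cmeasurable_sqr_norm _ _ _ _ A (cmeasurableB mf mh).
have m2 := @cmeasurable_sqr_norm _ _ _ _ A (cmeasurableB mh mg).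
have e1 : (0 <= 1 + e)%R by rewrite addr_ge0// ltW.
have e2 : (0 <= 1 + e^-1)%R by rewrite addr_ge0// ltW// invr_gt0.
rewrite /sqr_dist -!ge0_integralZl_EFin//; try by move=> t _; rewrite lee_fin sqr_ge0.
rewrite -ge0_integralD//; last 4 first.
- by move=> t _; rewrite mule_ge0// lee_fin ?sqr_ge0.
- exact: measurable_funeM.
- by move=> t _; rewrite mule_ge0// lee_fin ?sqr_ge0.
- exact: measurable_funeM.
apply: ge0_le_integral => //.
- by move=> t _; rewrite lee_fin sqr_ge0.
- exact: cmeasurable_sqr_norm (cmeasurableB mf mg).
- by apply: emeasurable_funD; exact: measurable_funeM.
- by move=> t _; rewrite -!EFinM -EFinD lee_fin; exact: sqr_normB_le.
Qed.

Lemma cvge0_near_le (u : nat -> \bar R) (e : R) : u @ \oo --> 0 -> (0 < e)%R ->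
  \forall n \near \oo, u n <= e%:E.
Proof.
move=> /fine_cvgP[fu /cvgrPdist_lt u0] e0.
have := u0 _ e0; apply: filterS2 fu => n fn; rewrite sub0r normrN => ue.
by rewrite -[u n]fineK// lee_fin (le_trans (ler_norm _))// ltW.
Qed.

End L2.

Section SpectralIntegralMass.
Variables (R : realType) (H : completeNormedModType R[i]).
Variables (ip : {dot H for Num.conj}) (Hip : norm_of_inner_product ip).
Variable E : set (measurableTypeR R) -> H -> H.
Hypothesis HE : projection_valued_measure ip E.
Implicit Types (A D : set (measurableTypeR R)) (x y z w : H).
Implicit Types (f g : measurableTypeR R -> R[i]).

Local Notation mu := (pvm_mass HE Hip).

Lemma cvg_pvm (u : nat -> H) x A : measurable A -> u @ \oo --> x ->
  (fun n => E A (u n)) @ \oo --> E A x.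
Proof.
move=> mA /hnorm_cvgP ux; apply/hnorm_cvgP.
apply: (squeeze_cvgr _ (@cvg_cst _ _ _ _ _) ux); near=> n.
by rewrite hnorm_ge0 -(pvmB HE)// (hnorm_pvm_le Hip HE).
Unshelve. all: by end_near. Qed.

(** Both sides are limits of the same quantities for simple functions, where equality is known. The
    scalar [d] is 0 for functions of [B] and 1 for the differences [exp(ihB) - 1]. *)
Lemma spectral_integralB_mass f x z (d : R[i]) A :
  cmeasurable f -> measurable A -> is_spectral_integral ip E f x z ->
  mu (z - d *: x) A = sqr_dist (mu x) A f (fun=> d).
Proof.
move=> mf mA [s [ms sf sz]].
pose W := hnorm (E A (z - d *: x)) ^+ 2.
pose u n := simple_integral E (s n) x - d *: x.
have W0 : 0 <= W by rewrite sqr_ge0.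
have cms n := measurable_simple_cmeasurable (ms n).
have cd : cmeasurable (fun _ : measurableTypeR R => d) by exact: cmeasurable_cst.
have uE n : (hnorm (E A (u n)) ^+ 2)%:E = sqr_dist (mu x) A (s n) (fun=> d).
  exact: (simple_integralB_mass Hip HE).
have cW : (fun n => hnorm (E A (u n)) ^+ 2) @ \oo --> W.
  have cu : u @ \oo --> z - d *: x.
    by apply: cvgB => //; exact: cvg_cst.
  have c := cvg_hnorm (cvg_pvm mA cu).
  by rewrite /W expr2; under eq_fun do rewrite /= expr2; exact: cvgM.
(* One index serves both the limit of the norms and the L^2 limit; the tolerance [e / (1 + 1/e)] in
   the latter absorbs its weight. *)
have approx e : 0 < e -> exists n, [/\ hnorm (E A (u n)) ^+ 2 <= W + e,
    W <= hnorm (E A (u n)) ^+ 2 + e &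
    ((1 + e^-1)%:E * sqr_dist (mu x) A f (s n) <= e%:E)%E].
  move=> e0; have e1 : 0 < 1 + e^-1 by rewrite addr_gt0// invr_gt0.
  have n1 : \forall n \near \oo, (sqr_dist (mu x) setT f (s n) <= (e / (1 + e^-1))%:E)%E.
    apply: cvge0_near_le; last by rewrite divr_gt0.
    by move: sf; under eq_fun do rewrite (sqr_integralE Hip HE).
  have /cvgrPdist_le/(_ e e0) n2 := cW.
  have [n [dn Wn]] := filter_ex (filterI n1 n2).
  exists n; move: Wn; rewrite ler_norml => /andP[Wn1 Wn2]; split; [lra|lra|].
  apply: (@le_trans _ _ ((1 + e^-1)%:E * sqr_dist (mu x) setT f (s n))%E).
    by rewrite lee_pmul2l// sqr_dist_setT.
  apply: (@le_trans _ _ ((1 + e^-1)%:E * (e / (1 + e^-1))%:E)%E).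
    by rewrite lee_pmul2l.
  by rewrite -EFinM lee_fin mulrC divfK// gt_eqF.
(* The weight [1/e] puts the mild factor [1 + e] on the term close to [W] and the large factor
   [1 + 1/e] on the small distance. *)
have up e : 0 < e -> (sqr_dist (mu x) A f (fun=> d) <= ((1 + e) * (W + e) + e)%:E)%E.
  move=> e0; have [n [Wn _ dn]] := approx e e0.
  have e0' : 0 < e^-1 by rewrite invr_gt0.
  apply: le_trans (sqr_dist_le _ e0' mf cd (cms n) mA) _.
  rewrite invrK addeC [leRHS]EFinD; apply: leeD => //.
  by rewrite -uE -EFinM lee_fin ler_pM2l// addr_gt0.
set L := sqr_dist _ _ _ _ in up *.
have L0 : (0 <= L)%E by exact: sqr_dist_ge0.
(* Finiteness of the integral comes from the bound just proved, at [e = 1]. *)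
have Lf : L \is a fin_num.
  by rewrite ge0_fin_numE// (le_lt_trans (up 1 ltr01))// ltry.
rewrite -[RHS]fineK// -[LHS]/(W%:E); congr EFin; apply/eqP; rewrite eq_le.
have fL0 : 0 <= fine L by exact: fine_ge0.
apply/andP; split; apply: le_perturb => // e e0; last first.
  by rewrite -lee_fin fineK//; exact: up.
have [n [_ Wn dn]] := approx e e0.
apply: (le_trans Wn).
suff : hnorm (E A (u n)) ^+ 2 <= (1 + e) * fine L + e by nra.
have e0' : 0 < e^-1 by rewrite invr_gt0.
rewrite -lee_fin uE; apply: le_trans (sqr_dist_le _ e0' (cms n) cd mf mA) _.
rewrite invrK addeC [leRHS]EFinD; apply: leeD; last by rewrite sqr_distC.
by rewrite EFinM fineK.
Qed.

Lemma hnorm_spectral_integralB_le f x z (d : R[i]) (b : R) A :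
  cmeasurable f -> measurable A -> is_spectral_integral ip E f x z ->
  0 <= b -> (forall l, A l -> complex.Re `|f l - d| <= b) ->
  hnorm (E A (z - d *: x)) <= b * hnorm (E A x).
Proof.
move=> mf mA fxz b0 fb.
rewrite -ler_sqr ?nnegrE ?mulr_ge0 ?hnorm_ge0// exprMn -lee_fin.
rewrite -[leLHS]/(mu (z - d *: x) A) (spectral_integralB_mass _ mf mA fxz)//.
rewrite EFinM -[X in (_ <= _ * X)%E]/(mu x A) -integral_cst//.
apply: ge0_le_integral => //.
- by move=> l _; rewrite lee_fin sqr_ge0.
- exact: cmeasurable_sqr_norm (cmeasurableB mf (cmeasurable_cst _ _)).
- by move=> l /fb fl; rewrite lee_fin ler_sqr ?nnegrE ?Re_norm_ge0.
Qed.

Lemma hnorm_spectral_integral_ge f x z (b : R) A :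
  cmeasurable f -> measurable A -> is_spectral_integral ip E f x z ->
  0 <= b -> (forall l, A l -> b <= complex.Re `|f l|) ->
  b * hnorm (E A x) <= hnorm (E A z).
Proof.
move=> mf mA fxz b0 fb.
rewrite -ler_sqr ?nnegrE ?mulr_ge0 ?hnorm_ge0// exprMn -lee_fin.
have := spectral_integralB_mass 0 mf mA fxz; rewrite scale0r subr0.
rewrite -[X in X = _]/((hnorm (E A z) ^+ 2)%:E) => ->.
rewrite EFinM -[X in (_ * X <= _)%E]/(mu x A) -integral_cst//.
apply: ge0_le_integral => //.
- by move=> l _; rewrite lee_fin sqr_ge0.
- exact: cmeasurable_sqr_norm (cmeasurableB mf (cmeasurable_cst _ _)).
- move=> l /fb fl; rewrite subr0 lee_fin ler_sqr ?nnegrE ?Re_norm_ge0//.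
Qed.

End SpectralIntegralMass.

Section SimpleApproximation.
Context d (T : measurableType d) (R : realType).

(** The positive and negative parts are approximated from below, with errors between 0 and the part
    itself. The total error is thus at most [|u|], as dominated convergence will require. *)
Lemma measurable_simple_approx (u : T -> R) : measurable_fun setT u ->
  exists h : nat -> T -> R, forall n, [/\ finite_set (range (h n)),
    measurable_fun setT (h n), forall t, `|u t - h n t| <= `|u t| &
    forall t, h ^~ t @ \oo --> u t].
Proof.
move=> mu.
have mp : measurable_fun setT (EFin \o u^\+).
  by apply/measurable_EFinP; exact: measurable_funrpos.
have mn : measurable_fun setT (EFin \o u^\-).
  by apply/measurable_EFinP; exact: measurable_funrneg.
pose g1 n := nnsfun_approx measurableT mp n.
pose g2 n := nnsfun_approx measurableT mn n.
have g1u n t : g1 n t <= u^\+ t.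
  by rewrite -lee_fin /g1 nnsfun_approxE; apply: le_approx => // s _; rewrite lee_fin.
have g2u n t : g2 n t <= u^\- t.
  by rewrite -lee_fin /g2 nnsfun_approxE; apply: le_approx => // s _; rewrite lee_fin.
have uE t : u t = u^\+ t - u^\- t by rewrite -[in LHS](funrposBneg u).
have uN t : `|u t| = u^\+ t + u^\- t.
  by rewrite -[RHS]/((u^\+ + u^\-) t) funrposDneg.
have cg1 t : g1 ^~ t @ \oo --> u^\+ t.
  have := cvg_nnsfun_approx measurableT mp (fun s _ => funrpos_ge0 u s) (I : setT t).
  by move/fine_cvgP => [].
have cg2 t : g2 ^~ t @ \oo --> u^\- t.
  have := cvg_nnsfun_approx measurableT mn (fun s _ => funrneg_ge0 u s) (I : setT t).
  by move/fine_cvgP => [].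
exists (fun n => g1 n \- g2 n) => n; split.
- exact: fimfunP.
- by apply: measurable_funB; exact: measurable_funPT.
- move=> t; rewrite uN uE -[(g1 n \- g2 n) t]/(g1 n t - g2 n t).
  have p1 : 0 <= g1 n t by exact: fun_ge0.
  have p2 : 0 <= g2 n t by exact: fun_ge0.
  have := g1u n t; have := g2u n t; rewrite ler_norml.
  by move: (g1 n t) (g2 n t) (u^\+ t) (u^\- t) p1 p2 => *; apply/andP; split; lra.
- by move=> t; rewrite uE; exact: cvgB.
Qed.

Lemma cvg_sqr_dist0 (u : nat -> R) (a : R) : u @ \oo --> a ->
  (fun n => (a - u n) ^+ 2) @ \oo --> (0 : R).
Proof.
move=> ua; have c : (fun n => a - u n) @ \oo --> a - a.
  by apply: cvgB => //; exact: cvg_cst.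
rewrite subrr in c; rewrite -(mulr0 (0 : R)).
by under eq_fun do rewrite expr2; exact: cvgM.
Qed.

End SimpleApproximation.

Section SpectralIntegralExistence.
Variables (R : realType) (H : completeNormedModType R[i]).
Variables (ip : {dot H for Num.conj}) (Hip : norm_of_inner_product ip).
Variable E : set (measurableTypeR R) -> H -> H.
Hypothesis HE : projection_valued_measure ip E.
Implicit Types (x z : H) (f : measurableTypeR R -> R[i]).

Local Notation mu := (pvm_mass HE Hip).

(** Simple approximations of the real and imaginary parts converge to [f] in L^2 by dominated
    convergence with majorant [|f|^2]. By the isometry their integrals form a Cauchy sequence in the
    complete space [H]. *)
Lemma spectral_integral_ex f x : cmeasurable f ->
  (sqr_integral ip E x f < +oo)%E -> exists z, is_spectral_integral ip E f x z.
Proof.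
move=> mf; rewrite (sqr_integralE Hip HE) => foo.
have [h1 h1P] := measurable_simple_approx mf.1.
have [h2 h2P] := measurable_simple_approx mf.2.
pose s0 n l : R[i] := (h1 n l +i* h2 n l)%C.
have fs n : finite_set (range (s0 n)).
  have [f1 _ _ _] := h1P n; have [f2 _ _ _] := h2P n.
  apply: (@sub_finite_set _ _ ((fun v => (v.1 +i* v.2)%C) @` (range (h1 n) `*` range (h2 n)))).
    by move=> _ [l _ <-]; exists (h1 n l, h2 n l) => //=; split; exists l.
  by apply: finite_image; exact: finite_setX.
pose s n : {fimfun measurableTypeR R >-> R[i]} :=
  HB.pack (s0 n) (FiniteImage.Build _ _ (s0 n) (fs n)).
have ms n : measurable_simple (s n).
  move=> c; have [_ m1 _ _] := h1P n; have [_ m2 _ _] := h2P n.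
  have -> : s n @^-1` [set c] =
      (h1 n @^-1` [set complex.Re c]) `&` (h2 n @^-1` [set complex.Im c]).
    by case: c => a b; apply/seteqP; split => l /=; [case=> <- <-|case=> <- <-].
  by apply: measurableI; rewrite -[X in measurable X]setTI; [apply: m1|apply: m2].
have cms n := measurable_simple_cmeasurable (ms n).
have sf : (fun n => sqr_dist (mu x) setT f (s n)) @ \oo --> 0%E.
  rewrite -(@integral0 _ _ _ (mu x) setT).
  apply: (@dominated_cvg _ _ _ (mu x) setT measurableT _ _
     (fun l => (complex.Re `|f l| ^+ 2)%:E)) => //.
  - by move=> n; exact: cmeasurable_sqr_norm (cmeasurableB mf (cms n)).
  - move=> l _; under eq_fun do rewrite Re_sqr_norm !raddfB /=.
    have [_ _ _ c1] := h1P 0%N; have [_ _ _ c2] := h2P 0%N.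
    apply: cvg_EFin; first by near=> n.
    rewrite -(addr0 (0 : R)).
    exact: (cvgD (cvg_sqr_dist0 (c1 l)) (cvg_sqr_dist0 (c2 l))).
  - apply/integrableP; split; first exact: cmeasurable_sqr_norm.
    by under eq_integral do rewrite gee0_abs ?lee_fin ?sqr_ge0//.
  - move=> n l _; rewrite gee0_abs ?lee_fin ?sqr_ge0//.
    have [_ _ b1 _] := h1P n; have [_ _ b2 _] := h2P n.
    rewrite !Re_sqr_norm !raddfB /=; apply: lerD.
      by rewrite -(real_normK (num_real (_ - _)))
        -(real_normK (num_real (complex.Re _))) ler_sqr ?nnegrE.
    by rewrite -(real_normK (num_real (_ - _)))
        -(real_normK (num_real (complex.Im _))) ler_sqr ?nnegrE.
have [z sz] : exists z, (fun n => simple_integral E (s n) x) @ \oo --> z.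
  apply: hnorm_cauchy_cvg => e e0.
  (* Weight 1 doubles each of the two squared distances to [f], so the total is at most
     [e^2 / 2]. *)
  have e8 : 0 < e ^+ 2 / 8 by rewrite divr_gt0// exprn_gt0.
  have [N _ sN] := cvge0_near_le sf e8.
  exists N => n m Nn Nm.
  rewrite -ltr_sqr ?nnegrE ?hnorm_ge0 ?(ltW e0)// -lte_fin.
  rewrite (simple_integral_dist Hip HE)//.
  rewrite -[ltLHS]/(sqr_dist (mu x) setT (s n) (s m)).
  apply: le_lt_trans (sqr_dist_le _ ltr01 (cms n) (cms m) mf measurableT) _.
  rewrite invr1 sqr_distC.
  apply: (@le_lt_trans _ _ ((1 + 1)%:E * (e ^+ 2 / 8)%:E + (1 + 1)%:E * (e ^+ 2 / 8)%:E)%E).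
    by apply: leeD; rewrite lee_pmul2l//; exact: sN.
  by rewrite -!EFinM -EFinD lte_fin; have := exprn_gt0 2 e0; lra.
exists z, s; split => //.
by under eq_fun do rewrite (sqr_integralE Hip HE); exact: sf.
Unshelve. all: by end_near. Qed.

Lemma spectral_integralP f x : cmeasurable f -> dom (spectral_integral ip E f) x ->
  is_spectral_integral ip E f x (spectral_integral ip E f x).
Proof. by move=> mf fx; have [z fxz] := spectral_integral_ex mf fx; exact: (xgetI 0 fxz). Qed.

End SpectralIntegralExistence.

(** * Functions of the operator *)

Section UnitaryFactor.
Variable R : realType.
Implicit Types a b : R.

(** By the mean value theorem [sin a = a cos c] for some [c]; both squares are even in [a], so
    [a >= 0] may be assumed. *)
Lemma sqr_sin_le a : sin a ^+ 2 <= a ^+ 2.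
Proof.
wlog a0 : a / 0 <= a => [wl|].
  have [|a0] := leP 0 a; first exact: wl.
  by rewrite -(sqrrN (sin a)) -sinN -(sqrrN a); apply: wl; rewrite oppr_ge0 ltW.
have [|c _] := @MVT_segment R sin cos 0 a a0 (fun x _ => is_derive_sin x).
  by apply: continuous_subspaceT => x; exact: continuous_sin.
rewrite sin0 !subr0 => ->; rewrite exprMn ler_piMl ?sqr_ge0//.
Qed.

(** Rests on [|exp(ia) - 1| = 2 |sin(a/2)|]. *)
Lemma normC_cis_sub1_le a :
  complex.Re `|(cos a +i* sin a)%C - 1| <= Num.min 2 `|a|.
Proof.
have E : complex.Re `|(cos a +i* sin a)%C - 1| ^+ 2 = 4 * sin (a / 2) ^+ 2.
  rewrite Re_sqr_norm !raddfB /= subr0.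
  have c2 := cos_mulr2n (a / 2); have aE : (a / 2) *+ 2 = a by rewrite mulr2n; lra.
  rewrite aE in c2; have := cos2Dsin2 (a / 2); have := cos2Dsin2 a.
  by rewrite c2; nra.
rewrite le_min -ler_sqr ?nnegrE ?Re_norm_ge0// E.
rewrite -[X in _ && X]ler_sqr ?nnegrE ?Re_norm_ge0// E real_normK ?num_real//.
apply/andP; split.
  by have := cos2Dsin2 (a / 2); have := sqr_ge0 (cos (a / 2)); lra.
by have := sqr_sin_le (a / 2); lra.
Qed.

Lemma cmeasurable_cis h :
  @cmeasurable _ (measurableTypeR R) R (fun l => (cos (h * l) +i* sin (h * l))%C).
Proof.
have mh : measurable_fun setT (fun l : measurableTypeR R => h * l).
  by apply: measurable_funM => //; exact: measurable_cst.
split => /=.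
- apply: (measurableT_comp _ mh); apply: continuous_measurable_fun => x.
  exact: continuous_cos.
- apply: (measurableT_comp _ mh); apply: continuous_measurable_fun => x.
  exact: continuous_sin.
Qed.

Lemma cmeasurable_real (g : measurableTypeR R -> R) : measurable_fun setT g ->
  cmeasurable (fun l => (g l)%:C%C).
Proof. by move=> mg; split => //=; exact: measurable_cst. Qed.

Lemma Re_norm_real a : complex.Re `|a%:C%C| = `|a|.
Proof. by rewrite normc_def /= expr0n addr0 sqrtr_sqr. Qed.

(* The truncation [Num.max 0] extends a function that is only monotone on the
   half-line to one that is monotone on the line. *)
Lemma nondecr_ge0_measurable (h : R -> R) :
  {in `[0, +oo[ &, {homo h : s t / s <= t}} ->
  measurable_fun setT (fun s : R => h (Num.max 0 s)).
Proof.
move=> hh; apply: nondecreasing_measurable => // s t st; apply: hh.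
- by rewrite in_itv /= le_max lexx.
- by rewrite in_itv /= le_max lexx.
- by rewrite ge_max !le_max lexx st orbT.
Qed.

Lemma even_nondecr_measurable (G : R -> R) : (forall l, G (- l) = G l) ->
  {in `[0, +oo[ &, {homo G : s t / s <= t}} -> measurable_fun setT G.
Proof.
move=> evenG hG.
have -> : G = (fun s => G (Num.max 0 s)) \o Num.norm.
  apply/funext => s /=; rewrite max_r//.
  by have [s0|s0] := leP 0 s; [rewrite ger0_norm|rewrite ltr0_norm].
apply: measurableT_comp; first exact: nondecr_ge0_measurable.
exact: normr_measurable.
Qed.

End UnitaryFactor.

Definition spectral_tail (R : realType) (b : R) : set (measurableTypeR R) :=
  [set l | b <= `|l|].

Lemma measurable_spectral_tail (R : realType) (b : R) : measurable (spectral_tail b).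
Proof.
rewrite (_ : spectral_tail b = Num.norm @^-1` [set` `[b, +oo[]); last first.
  by apply/seteqP; split => l /=; rewrite in_itv /= andbT.
by rewrite -[X in measurable X]setTI; exact: normr_measurable.
Qed.

Section Functions.
Variables (R : realType) (H : completeNormedModType R[i]).
Variables (ip : {dot H for Num.conj}) (Hip : norm_of_inner_product ip).
Variable E : set (measurableTypeR R) -> H -> H.
Hypothesis HE : projection_valued_measure ip E.
Implicit Types (A D : set (measurableTypeR R)) (x y z w : H).

Lemma unitary_group_dom h x : dom (unitary_group ip E h) x.
Proof.
rewrite /= (sqr_integralE Hip HE).
rewrite (eq_integral (cst 1%E)) ?integral_cst//.
  by rewrite mul1e -[ltLHS]/((hnorm (E setT x) ^+ 2)%:E) ltry.
by move=> l _; rewrite Re_sqr_norm /= cos2Dsin2.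
Qed.

(** Each difference integrates [exp(ihl) - 1], of modulus at most [b] on [A], and so costs one
    factor [b]. *)
Lemma hnorm_difference_le h k w (b : R) A : measurable A -> 0 <= b ->
  (forall l, A l -> Num.min 2 `|h * l| <= b) ->
  hnorm (E A (difference ip E h k w)) <= b ^+ k * hnorm (E A w).
Proof.
move=> mA b0 hb; elim: k => [|k ih]; first by rewrite expr0 mul1r.
rewrite /difference iterS -/(difference ip E h k w).
set v := difference ip E h k w in ih *.
have mc := cmeasurable_cis h.
have iv := spectral_integralP Hip HE mc (unitary_group_dom h v).
have := @hnorm_spectral_integralB_le R H ip Hip E HE _ _ _ 1 b _ mc mA iv b0.
rewrite scale1r => le1; apply: (le_trans (le1 _)).
  by move=> l Al; apply: le_trans (normC_cis_sub1_le _) (hb l Al).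
by rewrite exprS -mulrA ler_wpM2l.
Qed.

Lemma hnorm_real_function_le (G : R -> R) x (g : R) A : measurable_fun setT G ->
  dom (real_function_of ip E G) x -> measurable A -> 0 <= g ->
  (forall l, A l -> `|G l| <= g) ->
  hnorm (E A (real_function_of ip E G x)) <= g * hnorm (E A x).
Proof.
move=> mG Gx mA g0 gb; have mc := cmeasurable_real mG.
have iv := spectral_integralP Hip HE mc Gx.
have := @hnorm_spectral_integralB_le R H ip Hip E HE _ _ _ 0 g _ mc mA iv g0.
rewrite scale0r subr0; apply => l Al.
by rewrite subr0 Re_norm_real; exact: gb.
Qed.

Section Shells.
Variable S : (set (measurableTypeR R))^nat.
Hypotheses (mS : forall n, measurable (S n)) (tS : trivIset setT S).
Hypothesis SE : \bigcup_n S n = setT.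

(** Countable additivity and the triangle inequality; sums of norms are what the dyadic sums of
    [omega] will control. *)
Lemma hnorm_le_shells w (K : R) :
  (forall n, \sum_(i < n) hnorm (E (S i) w) <= K) -> hnorm w <= K.
Proof.
move=> wK; have := cvg_hnorm (@pvm_bigcup _ _ _ _ HE S w mS tS).
rewrite SE (pvm_setT HE) => cw.
apply: (ler_cvg_to cw (@cvg_cst _ K _ _ _)); near=> n.
by apply: le_trans (wK n); exact: (hnorm_sum (fun i => E (S i) w)).
Unshelve. all: by end_near. Qed.

(** The integral of [|G|^2] over [S n] is at most the square of [g n |E(S n)x|], and a sum of
    squares of nonnegative numbers is at most the square of their sum. *)
Lemma real_function_dom_shells (G : R -> R) (g : nat -> R) x (K : R) :
  measurable_fun setT G -> (forall n, 0 <= g n) ->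
  (forall n l, S n l -> `|G l| <= g n) ->
  (forall n, \sum_(i < n) g i * hnorm (E (S i) x) <= K) ->
  dom (real_function_of ip E G) x.
Proof.
move=> mG g0 Gg xK; rewrite /= (sqr_integralE Hip HE) -SE.
have mG2 A : measurable_fun A
    (fun l : measurableTypeR R => (complex.Re `|(G l)%:C%C| ^+ 2)%:E).
  exact: cmeasurable_sqr_norm (cmeasurable_real mG).
rewrite ge0_integral_bigcup//; last by move=> l _; rewrite lee_fin sqr_ge0.
have a0 i : 0 <= g i * hnorm (E (S i) x) by rewrite mulr_ge0 ?hnorm_ge0.
have sqs n : \sum_(i < n) (g i * hnorm (E (S i) x)) ^+ 2 <=
    (\sum_(i < n) g i * hnorm (E (S i) x)) ^+ 2.
  elim: n => [|n ih]; first by rewrite !big_ord0 expr0n.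
  rewrite !big_ord_recr /= sqrrD -addrA; apply: lerD => //.
  by rewrite lerDr mulrn_wge0// mulr_ge0// sumr_ge0.
apply: (@le_lt_trans _ _ (K ^+ 2)%:E); last exact: ltry.
apply: lime_le.
  by apply: is_cvg_nneseries => n _ _; apply: integral_ge0 => l _; rewrite lee_fin sqr_ge0.
near=> n; apply: (@le_trans _ _ (\sum_(0 <= i < n) ((g i * hnorm (E (S i) x)) ^+ 2)%:E)%E).
  apply: lee_sum => i _; rewrite exprMn EFinM.
  rewrite -[X in (_ <= _ * X)%E]/(pvm_mass HE Hip x (S i)) -integral_cst//.
  apply: ge0_le_integral => //.
  - by move=> l _; rewrite lee_fin sqr_ge0.
  - by move=> l /Gg Gl; rewrite lee_fin Re_norm_real ler_sqr ?nnegrE.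
rewrite sumEFin lee_fin big_mkord.
apply: le_trans (sqs n) _.
(* The empty sum shows [K >= 0], so that squares can be compared. *)
by rewrite ler_sqr ?nnegrE ?sumr_ge0// (le_trans _ (xK 0%N))// big_ord0.
Unshelve. all: by end_near. Qed.

End Shells.

End Functions.

(** * Best approximation by vectors of exponential type *)

Section BestApproximation.
Variables (R : realType) (H : completeNormedModType R[i]).
Variables (ip : {dot H for Num.conj}) (Hip : norm_of_inner_product ip).
Variables (B : operator H) (linB : linear_operator B).
Variable E : set (measurableTypeR R) -> H -> H.
Hypothesis HE : spectral_measure_of ip E B.
Implicit Types (x y : H) (a b r : R).

Let pE : projection_valued_measure ip E := HE.1.

Lemma hnorm_tail_operator_ge b y : 0 <= b -> dom B y ->
  b * hnorm (E (spectral_tail b) y) <= hnorm (E (spectral_tail b) (B y)).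
Proof.
move=> b0; have [_ [dB BE]] := HE => By; rewrite BE//.
rewrite dB in By; have mid : cmeasurable (fun l : measurableTypeR R => l%:C%C).
  by apply: cmeasurable_real; exact: measurable_id.
have iv := spectral_integralP Hip pE mid By.
apply: (hnorm_spectral_integral_ge Hip pE mid) => //.
- exact: measurable_spectral_tail.
- by move=> l; rewrite Re_norm_real.
Qed.

Lemma hnorm_tail_iter_ge b y k : 0 <= b -> smooth_vectors B y ->
  b ^+ k * hnorm (E (spectral_tail b) y) <= hnorm (E (spectral_tail b) (iter k B y)).
Proof.
move=> b0 sy; elim: k => [|k ih]; first by rewrite mul1r.
have [_ By] := sy k.+1 I.
apply: le_trans (hnorm_tail_operator_ge b0 By).
by rewrite exprS -mulrA ler_wpM2l.
Qed.

(** Applying [B] [k] times multiplies the tail norm by at least [b^k], while the result is at most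
    [c a^k]. So the tail norm is at most [c (a/b)^k], which tends to 0. *)
Lemma exp_vectors_le_tail a b y : 0 < a -> a < b -> exp_vectors_le B a y ->
  E (spectral_tail b) y = 0.
Proof.
move=> a0 ab [sy [c c0 yc]]; have b0 := lt_trans a0 ab.
apply: hnorm_eq0; apply/eqP; rewrite eq_le hnorm_ge0 andbT.
set v := hnorm _; have vle k : v <= c * (a / b) ^+ k.
  rewrite expr_div_n mulrA ler_pdivlMr ?exprn_gt0// mulrC.
  apply: le_trans (hnorm_tail_iter_ge k (ltW b0) sy) _.
  apply: le_trans (yc k); apply: (hnorm_pvm_le Hip pE).
  exact: measurable_spectral_tail.
have q1 : `|a / b| < 1 by rewrite ger0_norm ?divr_ge0 ?ltW// ltr_pdivrMr// mul1r.
have c0' : (fun k => c * (a / b) ^+ k) @ \oo --> c * 0.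
  by apply: cvgM; [exact: cvg_cst|exact: cvg_expr].
rewrite mulr0 in c0'.
by apply: (ler_cvg_to (@cvg_cst _ v _ _ _) c0'); near=> k.
Unshelve. all: by end_near. Qed.

Lemma exp_type_tail r b y : exp_vectors B y -> exp_type B y <= r -> r < b ->
  E (spectral_tail b) y = 0.
Proof.
move=> [a0 /= a00 ya0] yr rb.
have [||a [a1 ya] ab] := @inf_lt R [set a | 0 < a /\ exp_vectors_le B a y] b.
- by exists a0.
- exact: le_lt_trans rb.
exact: exp_vectors_le_tail ya.
Qed.

(** Provides an element of the set of approximants, whose infimum would be a default value if the
    set were empty. *)
Lemma exp_vectors_le0 a : 0 < a -> exp_vectors_le B a 0.
Proof.
move=> a0; have [dB0 BL] := linB.
have B0 : B 0 = 0.
  by have [_] := BL (-1) 0 0 dB0 dB0; rewrite !scaleN1r oppr0 add0r addNr.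
have it k : iter k B 0 = 0 by elim: k => //= k ->.
split; last by exists 1 => // k; rewrite it hnorm0 mul1r exprn_ge0// ltW.
by move=> n _; elim: n => [|n ih] //=; split => //; rewrite it.
Qed.

(** Every competitor [y] is killed by the tail projection, so [x] and [x - y] have the same tail. *)
Lemma hnorm_tail_le_best_approx r b x : 0 < r -> r < b ->
  hnorm (E (spectral_tail b) x) <= best_approx B r x.
Proof.
move=> r0 rb; apply: lb_le_inf.
  exists (hnorm (x - 0)), 0 => //; split; first by exists 1 => //=; exact: exp_vectors_le0.
  (* [r] itself is admissible in the infimum that defines the type of 0. *)
  apply: ge_inf; last by split => //; exact: exp_vectors_le0.
  by exists 0 => s [/ltW].
move=> _ [y [ey ty] <-]; have mb := measurable_spectral_tail b.
rewrite -[X in hnorm X]subr0 -(exp_type_tail ey ty rb) -(pvmB pE)//.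
exact: (hnorm_pvm_le Hip pE).
Qed.

End BestApproximation.

(** * Dyadic sums *)

Section DyadicSums.
Variable R : realType.
Local Notation mu := (@lebesgue_measure R).

Local Notation dyadic_itv i := (`]2 ^- (i%N).+1, 2 ^- (i%N)]%classic : set R).

Let exp2N_gt0 i : 0 < 2 ^- i :> R. Proof. by rewrite invr_gt0 exprn_gt0. Qed.

Let exp2NS i : 2 ^- i.+1 = 2 ^- i / 2 :> R.
Proof. by rewrite exprS invfM mulrC. Qed.

Lemma exp2N_le (i j : nat) : (i <= j)%N -> 2 ^- j <= 2 ^- i :> R.
Proof. by move=> ij; rewrite lef_pV2 ?posrE ?exprn_gt0// ler_eXn2l// ltr1n. Qed.

(** Each selected term is a lower bound of [f] on a dyadic interval times its length; these
    intervals are disjoint and lie in [D]. The shift [s] allows term [i] to be charged to a smaller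
    interval. *)
Lemma dyadic_sum_le_integral (f : R -> R) (D : set R) (P : pred nat)
    (v : nat -> R) (s n : nat) :
  measurable D -> measurable_fun D f -> (forall t, D t -> 0 <= f t) ->
  (forall i, P i -> [/\ dyadic_itv (i + s) `<=` D, 0 <= v i &
     forall t, dyadic_itv (i + s) t -> v i <= f t]) ->
  ((\sum_(i < n | P i) v i * 2 ^- (i + s).+1)%:E <= \int[mu]_(t in D) (f t)%:E)%E.
Proof.
move=> mD mf f0 Pv.
pose l := [seq i <- iota 0 n | P i].
have Pl i : i \in l -> P i by rewrite mem_filter => /andP[].
pose U := \big[setU/set0]_(i <- l) dyadic_itv (i + s).
have mJ i : measurable (dyadic_itv i) by exact: measurable_itv.
have UD : U `<=` D.
  move=> t; rewrite /U -bigcup_seq => -[i /= il]; have [h _ _] := Pv _ (Pl _ il).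
  exact: h.
have mU : measurable U by apply: bigsetU_measurable.
have mfD : measurable_fun D (EFin \o f) by exact/measurable_EFinP.
apply: (@le_trans _ _ (\int[mu]_(t in U) (f t)%:E)%E); last first.
  by apply: ge0_subset_integral => // t Dt; rewrite lee_fin f0.
rewrite ge0_integral_bigsetU//; last 4 first.
- by rewrite filter_uniq// iota_uniq.
- move=> i j _ _ [t [/=]]; rewrite !in_itv /= => /andP[ti it] /andP[tj jt].
  apply/eqP; rewrite -(eqn_add2r s) eqn_leq; apply/andP; split.
    rewrite leqNgt; apply/negP => /exp2N_le h.
    by have := lt_le_trans tj (le_trans it h); rewrite ltxx.
  rewrite leqNgt; apply/negP => /exp2N_le h.
  by have := lt_le_trans ti (le_trans jt h); rewrite ltxx.
- exact: measurable_funS mfD.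
- by move=> t /UD /f0; rewrite lee_fin.
rewrite -(big_mkord P (fun i => v i * 2 ^- (i + s).+1)) /index_iota subn0.
rewrite -[X in (X%:E <= _)%E]big_filter -sumEFin big_seq [leRHS]big_seq.
apply: lee_sum => i il; have [JD v0 vf] := Pv _ (Pl _ il).
have -> : ((v i * 2 ^- (i + s).+1)%:E =
    \int[mu]_(t in dyadic_itv (i + s)) (v i)%:E)%E.
  rewrite integral_cst//= lebesgue_measure_itv /= lte_fin.
  have -> : 2 ^- (i + s).+1 < 2 ^- (i + s) :> R.
    by have := exp2N_gt0 (i + s); rewrite exp2NS; lra.
  rewrite -EFinB -EFinM; congr (_ * _)%:E; rewrite exp2NS; lra.
apply: ge0_le_integral => //; first exact: measurable_funS mfD.
Qed.

Lemma measurable_div_expr (omega : R -> R) (D : set R) (k : nat) :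
  {in `[0, +oo[ &, {homo omega : s t / s <= t}} ->
  measurable D -> D `<=` [set t | 0 < t] ->
  measurable_fun D (fun t => omega t / t ^+ k).
Proof.
move=> mono mD D0; apply: measurable_funM.
  apply: (@eq_measurable_fun _ _ _ _ D (fun t => omega (Num.max 0 t))).
    by move=> t; rewrite inE => /D0 /= t0; rewrite max_r// ltW.
  exact: (measurable_funS measurableT) (nondecr_ge0_measurable mono).
(* On positive numbers inversion is the real power of exponent -1, which is measurable. *)
apply: (@eq_measurable_fun _ _ _ _ D ((fun s : R => s `^ (-1)) \o (fun t => t ^+ k))).
  move=> t; rewrite inE => /D0 /= t0.
  by rewrite powR_inv1// exprn_ge0// ltW.
apply: measurableT_comp; first exact: measurable_powR.
by apply: (measurable_funS measurableT) => //; exact: measurable_funX.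
Qed.

Section Modulus.
Variables (omega : R -> R) (c : R).
Hypotheses (mono : {in `[0, +oo[ &, {homo omega : s t / s <= t}}) (omega0 : omega 0 = 0).
Hypotheses (c0 : 0 < c) (doubling : forall t, 0 < t -> omega (2 * t) <= c * omega t).
Hypothesis dini : (\int[mu]_(t in `]0%R, 1%R]) (omega t / t)%:E < +oo)%E.

Let omega_le s t : 0 <= s -> s <= t -> omega s <= omega t.
Proof. by move=> s0 st; apply: mono; rewrite ?in_itv //= ?andbT// (le_trans s0). Qed.

Lemma omega_ge0 t : 0 <= t -> 0 <= omega t.
Proof. by move=> t0; rewrite -omega0; exact: omega_le. Qed.

Let omega_dyadic i : omega (2 ^- i) <= c * omega (2 ^- i.+1).
Proof.
have -> : 2 ^- i = 2 * 2 ^- i.+1 :> R by rewrite exp2NS mulrC divfK.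
exact: doubling.
Qed.

(** A real-valued integral is [fine] of the extended one, so comparing it with sums requires
    finiteness. *)
Lemma dini_fin_num t : 0 < t <= 1 ->
  (\int[mu]_(s in `]0%R, t]) (omega s / s)%:E)%E \is a fin_num.
Proof.
move=> /andP[t0 t1].
have m0 s : `]0, 1]%classic s -> (0 <= (omega s / s)%:E)%E.
  rewrite /= in_itv /= => /andP[s0 _].
  by rewrite lee_fin divr_ge0 ?omega_ge0 ?ltW.
have sub : `]0, t]%classic `<=` (`]0, 1]%classic : set R).
  by move=> s /=; rewrite !in_itv /= => /andP[-> /le_trans]; exact.
rewrite ge0_fin_numE; last by apply: integral_ge0 => s /sub; exact: m0.
apply: le_lt_trans dini; apply: ge0_subset_integral => //.
apply/measurable_EFinP; apply: (@measurable_div_expr _ _ 1) => // s /=.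
by rewrite in_itv /= => /andP[].
Qed.

(** On the interval of integration the integrand is at most [omega 1 / t^k]. *)
Lemma tail_integral_fin_num t k : 0 < t <= 1 ->
  (\int[mu]_(s in `[t, 1%R]) (omega s / s ^+ k)%:E)%E \is a fin_num.
Proof.
move=> /andP[t0 t1].
have m0 s : `[t, 1]%classic s -> (0 <= (omega s / s ^+ k)%:E)%E.
  rewrite /= in_itv /= => /andP[s0 _].
  have s0' : 0 <= s by rewrite (le_trans _ s0)// ltW.
  by rewrite lee_fin divr_ge0 ?omega_ge0 ?exprn_ge0.
rewrite ge0_fin_numE; last by apply: integral_ge0 => s; exact: m0.
apply: (@le_lt_trans _ _ (\int[mu]_(s in `[t, 1%R]) (omega 1 / t ^+ k)%:E)%E).
  apply: ge0_le_integral => //.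
    apply/measurable_EFinP; apply: measurable_div_expr => // s /=.
    by rewrite in_itv /= => /andP[/(lt_le_trans t0)].
  move=> s /=; rewrite in_itv /= => /andP[ts s1]; rewrite lee_fin.
  have s0 := lt_le_trans t0 ts.
  apply: ler_pM; rewrite ?omega_ge0 ?invr_ge0 ?exprn_ge0 ?(ltW s0)//.
    by apply: omega_le => //; exact: ltW.
  by rewrite lef_pV2 ?posrE ?exprn_gt0// lerXn2r// nnegrE ltW.
rewrite integral_cst//= lebesgue_measure_itv /=.
by case: ifP => _; rewrite ?mule0 ?ltry// -EFinB -EFinM ltry.
Qed.

(** The condition on [i] only places the next interval, from [2^-(i+2)] to [2^-(i+1)], below [t];
    hence the shift 1. It contributes at least [omega(2^-(i+2)) / 2], and two doublings lead back to
    [omega(2^-i)], whence [2 c^2]. *)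
Lemma dyadic_sum_le_dini t n : 0 < t <= 1 ->
  \sum_(i < n | 2 ^- i.+1 <= t) omega (2 ^- i) <=
  2 * c ^+ 2 * \int[mu]_(s in `]0, t]) (omega s / s).
Proof.
move=> t01; have /andP[t0 t1] := t01.
rewrite -lee_fin EFinM fineK ?dini_fin_num//.
have pos s : `]0, t]%classic s -> 0 < s by rewrite /= in_itv /= => /andP[].
pose v i := omega (2 ^- i.+2) * 2 ^+ i.+1.
have Pv i : 2 ^- i.+1 <= t -> [/\ dyadic_itv (i + 1) `<=` `]0, t], 0 <= v i &
     forall s, dyadic_itv (i + 1) s -> v i <= omega s / s].
  rewrite addn1 => it; split.
  - move=> s /=; rewrite !in_itv /= => /andP[/(lt_trans (exp2N_gt0 _)) -> /=].
    by move=> /le_trans; exact.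
  - by rewrite mulr_ge0 ?omega_ge0 ?exprn_ge0 ?ltW.
  move=> s /=; rewrite in_itv /= => /andP[ls us].
  have s0 := lt_trans (exp2N_gt0 _) ls.
  apply: ler_pM; rewrite ?omega_ge0 ?exprn_ge0 ?(ltW (exp2N_gt0 _))//.
    by apply: omega_le; exact: ltW.
  by rewrite -[X in X <= _]invrK lef_pV2 ?posrE.
have mf : measurable_fun `]0, t] (fun s => omega s / s).
  by apply: (@measurable_div_expr _ _ 1) => // s; exact: pos.
have := @dyadic_sum_le_integral _ _ (fun i => 2 ^- i.+1 <= t) v 1 n _ mf _ Pv.
move=> /(_ (measurable_itv _)) le1.
apply: (@le_trans _ _ ((2 * c ^+ 2)%:E *
   (\sum_(i < n | 2 ^- i.+1 <= t) v i * 2 ^- (i + 1).+1)%:E)%E); last first.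
  rewrite lee_pmul2l// ?lte_fin ?mulr_gt0 ?exprn_gt0//; apply: le1 => s /pos s0.
  by rewrite divr_ge0 ?omega_ge0// ltW.
rewrite -EFinM lee_fin mulr_sumr; apply: ler_sum => i _.
have -> : 2 * c ^+ 2 * (v i * 2 ^- (i + 1).+1) = c * (c * omega (2 ^- i.+2)).
  rewrite /v addn1 exp2NS.
  by field; rewrite expf_neq0.
by apply: le_trans (omega_dyadic i) _; rewrite ler_pM2l.
Qed.

(** Here the interval from [2^-(i+1)] to [2^-i] itself lies above [t]. It contributes at least
    [2^(ik) omega(2^-(i+1)) / 2], and one doubling suffices, whence [2 c]. *)
Lemma dyadic_sum_le_tail_integral t k n : 0 < t <= 1 ->
  \sum_(i < n | t <= 2 ^- i.+1) 2 ^+ (i * k) * omega (2 ^- i) <=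
  2 * c * \int[mu]_(s in `[t, 1]) (omega s / s ^+ k.+1).
Proof.
move=> t01; have /andP[t0 t1] := t01.
rewrite -lee_fin EFinM fineK ?tail_integral_fin_num//.
have pos s : `[t, 1]%classic s -> 0 < s.
  by rewrite /= in_itv /= => /andP[/(lt_le_trans t0)].
pose v i := omega (2 ^- i.+1) * 2 ^+ (i * k.+1).
have Pv i : t <= 2 ^- i.+1 -> [/\ dyadic_itv (i + 0) `<=` `[t, 1], 0 <= v i &
     forall s, dyadic_itv (i + 0) s -> v i <= omega s / s ^+ k.+1].
  rewrite addn0 => it; split.
  - move=> s /=; rewrite !in_itv /= => /andP[ls us].
    rewrite (le_trans it (ltW ls)) (le_trans us)//.
    by have := exp2N_le (leq0n i); rewrite expr0 invr1.
  - by rewrite mulr_ge0 ?omega_ge0 ?exprn_ge0 ?ltW.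
  move=> s /=; rewrite in_itv /= => /andP[ls us].
  have s0 := lt_trans (exp2N_gt0 _) ls.
  apply: ler_pM; rewrite ?omega_ge0 ?exprn_ge0 ?(ltW (exp2N_gt0 _))//.
    by apply: omega_le; exact: ltW.
  rewrite -[X in X <= _]invrK lef_pV2 ?posrE ?exprn_gt0 ?invr_gt0 ?exprn_gt0//.
  by rewrite exprM -exprVn lerXn2r// nnegrE ltW.
have mf : measurable_fun `[t, 1] (fun s => omega s / s ^+ k.+1).
  by apply: measurable_div_expr => // s; exact: pos.
have := @dyadic_sum_le_integral _ _ (fun i => t <= 2 ^- i.+1) v 0 n _ mf _ Pv.
move=> /(_ (measurable_itv _)) le1.
apply: (@le_trans _ _ ((2 * c)%:E *
   (\sum_(i < n | t <= 2 ^- i.+1) v i * 2 ^- (i + 0).+1)%:E)%E); last first.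
  rewrite lee_pmul2l// ?lte_fin ?mulr_gt0//; apply: le1 => s /pos s0.
  by rewrite divr_ge0 ?omega_ge0 ?exprn_ge0// ltW.
rewrite -EFinM lee_fin mulr_sumr; apply: ler_sum => i _.
have -> : 2 * c * (v i * 2 ^- (i + 0).+1) = 2 ^+ (i * k) * (c * omega (2 ^- i.+1)).
  rewrite /v addn0 mulnS exprD exp2NS.
  by field; rewrite expf_neq0.
by rewrite ler_pM2l ?exprn_gt0.
Qed.

End Modulus.

End DyadicSums.

(** * Estimates on dyadic shells *)

Section DyadicShells.
Variable R : realType.

(** The inner radius [2^(k+1)] of shell [k+1] strictly exceeds the order [r = 2^k] at which the
    approximation hypothesis is applied to it. *)
Definition spectral_shell (n : nat) : set (measurableTypeR R) :=
  if n is k.+1 then spectral_tail (2 ^+ k.+1) `\` spectral_tail (2 ^+ k.+2)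
  else ~` spectral_tail 2.

Lemma measurable_spectral_shell n : measurable (spectral_shell n).
Proof.
case: n => [|n]; first by apply: measurableC; exact: measurable_spectral_tail.
by apply: measurableD; exact: measurable_spectral_tail.
Qed.

Lemma spectral_shell_lt n l : spectral_shell n l -> `|l| < 2 ^+ n.+1.
Proof.
by case: n => [|n] /=; [move=> /negP|move=> [_ /negP]]; rewrite -ltNge.
Qed.

Lemma trivIset_spectral_shell : trivIset setT spectral_shell.
Proof.
move=> i j _ _ [l [li lj]]; apply/eqP; rewrite eqn_leq.
suff le m n : spectral_shell m l -> spectral_shell n l -> (m <= n)%N.
  by rewrite (le i j)// (le j i).
case: m => [//|m] [ml _] /spectral_shell_lt nl; rewrite leqNgt; apply/negP => mn.
have := le_lt_trans ml nl.
by rewrite ltr_eXn2l ?ltr1n// ltnNge mn.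
Qed.

Lemma bigcup_spectral_shell : \bigcup_n spectral_shell n = setT.
Proof.
apply/seteqP; split => // l _.
have [n ln] : exists n, `|l| < 2 ^+ n.+1.
  exists (Num.bound `|l|); apply: lt_trans (archi_boundP (normr_ge0 l)) _.
  by rewrite -natrX ltr_nat (leq_trans (ltn_expl _ (ltnSn 1)))// leq_exp2l.
(* Descent to the least exponent that still bounds [|l|], which identifies the shell. *)
elim: n ln => [|n ih] ln; first by exists 0%N => //; apply/negP; rewrite -ltNge.
have [/ih//|nl] := ltP `|l| (2 ^+ n.+1).
by exists n.+1 => //; split => //; apply/negP; rewrite -ltNge.
Qed.

End DyadicShells.

(** * The doubling constant of the weight and the summation over shells *)

Lemma ereal_sup_ratio_bound (R : realType) (G : R -> R) :
  (forall l, 0 < l -> 0 < G l) ->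
  (ereal_sup [set (G (2 * l) / G l)%:E | l in [set l : R | (0 < l)%R]] < +oo)%E ->
  exists2 C : R, 0 < C & forall l, 0 < l -> G (2 * l) <= C * G l.
Proof.
move=> G0; set S := ereal_sup _ => Soo.
have GS l : 0 < l -> ((G (2 * l) / G l)%:E <= S)%E.
  by move=> l0; apply: ereal_sup_ubound; exists l.
have Sf : S \is a fin_num.
  by rewrite fin_numElt Soo andbT (lt_le_trans (ltNyr _) (GS 1 ltr01)).
have le l : 0 < l -> G (2 * l) <= fine S * G l.
  by move=> l0; rewrite -ler_pdivrMr ?G0// -lee_fin fineK// GS.
exists (fine S) => //.
(* The constant is positive because [0 < G 2 <= C G 1] and [G 1 > 0]. *)
have := lt_le_trans (G0 (2 * 1) _) (le 1 ltr01).
by rewrite mulr1 ltr0n => /(_ isT); rewrite pmulr_lgt0// G0.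
Qed.

Theorem theorem1p2 (R : realType) (H : completeNormedModType R[i])
  (ip : {dot H for Num.conj}) (Hip : norm_of_inner_product ip)
  (Hsep : separable H)
  (B : operator H) (HB : self_adjoint ip B)
  (E : set (measurableTypeR R) -> H -> H) (HE : spectral_measure_of ip E B)
  (omega : R -> R)
  (omega_cont : {within `[0, +oo[, continuous omega})
  (omega_nondecr : {in `[0, +oo[ &, {homo omega : s t / s <= t}})
  (omega0 : omega 0 = 0)
  (omega_doubling : exists2 c : R, 0 < c &
     forall t : R, 0 < t -> omega (2 * t) <= c * omega t)
  (omega_dini :
     (\int[lebesgue_measure]_(t in `]0%R, 1%R]) (omega t / t)%:E < +oo)%E)
  (G : R -> R)
  (G_ge0 : forall l : R, 0 <= G l)
  (G_even : forall l : R, G (- l) = G l)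
  (G_nondecr : {in `[0, +oo[ &, {homo G : l l' / l <= l'}})
  (G_gt0 : forall l : R, 0 < l -> 0 < G l)
  (G_doubling :
     (ereal_sup [set (G (2 * l) / G l)%:E | l in [set l : R | (0 < l)%R]] < +oo)%E)
  (x : H)
  (Hx : exists2 m : R, 0 < m &
     forall r : R, 0 < r -> best_approx B r x < m / G r * omega (1 / r)) :
  dom (real_function_of ip E G) x /\
  forall k : nat, (0 < k)%N ->
    exists2 m_k : R, 0 < m_k &
      forall t : R, 0 < t <= 1 / 2 ->
        modulus ip E k t (real_function_of ip E G x) <=
        m_k * (t ^+ k *
                 \int[lebesgue_measure]_(tau in `[t, 1]) (omega tau / tau ^+ k.+1)
               + \int[lebesgue_measure]_(tau in `]0, t]) (omega tau / tau)).
Proof.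
have [c c0 dbl] := omega_doubling; have [m m0 xm] := Hx.
have [C C0 GC] := ereal_sup_ratio_bound G_gt0 G_doubling.
have pE := HE.1; have [linB _ _] := HB.
pose S := @spectral_shell R.
have mS n : measurable (S n) by exact: measurable_spectral_shell.
have tS : trivIset setT S by exact: trivIset_spectral_shell.
have SE : \bigcup_n S n = setT by exact: bigcup_spectral_shell.
have mG : measurable_fun setT G by exact: even_nondecr_measurable.
have om0 t : 0 <= t -> 0 <= omega t by exact: omega_ge0.
have p2 n : 0 < 2 ^+ n :> R by rewrite exprn_gt0.
(* [g n] bounds [G] on shell [n], so [a n] will bound the norm of [E(S n)G(B)x]. *)
pose g n := G (2 ^+ n.+1); pose a n := g n * hnorm (E (S n) x).
have g0 n : 0 <= g n by exact: G_ge0.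
have Gg n l : S n l -> `|G l| <= g n.
  move=> /spectral_shell_lt /ltW ln; rewrite ger0_norm//.
  have -> : G l = G `|l| by have [l0|l0] := leP 0 l; [rewrite ger0_norm|rewrite ltr0_norm].
  by apply: G_nondecr; rewrite ?in_itv /= ?andbT// ltW.
have tail n : hnorm (E (S n.+1) x) <= m / G (2 ^+ n) * omega (2 ^- n).
  have -> : E (S n.+1) x = E (S n.+1) (E (spectral_tail (2 ^+ n.+1)) x).
    rewrite (pvmI Hip pE)//; last exact: measurable_spectral_tail.
    by congr (E _ x); apply/esym/setIidPl => l [].
  apply: le_trans (hnorm_pvm_le Hip pE _ (mS _)) _.
  apply: (@le_trans _ _ (best_approx B (2 ^+ n) x)).
    by apply: (hnorm_tail_le_best_approx Hip linB HE) => //; rewrite ltr_eXn2l ?ltr1n.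
  by have := xm _ (p2 n); rewrite div1r => /ltW.
(* Two doublings take [G(2^(n+2))] to [C^2 G(2^n)], which cancels the denominator in the hypothesis
   at [r = 2^n]. *)
pose M := C ^+ 2 * m.
have M0 : 0 < M by rewrite mulr_gt0 ?exprn_gt0.
have aM n : a n.+1 <= M * omega (2 ^- n).
  have GG : g n.+1 <= C ^+ 2 * G (2 ^+ n).
    rewrite /g exprS; apply: (le_trans (GC _ (p2 _))).
    by rewrite expr2 -mulrA ler_pM2l// exprS; exact: GC.
  apply: (@le_trans _ _ (C ^+ 2 * G (2 ^+ n) * (m / G (2 ^+ n) * omega (2 ^- n)))).
    by apply: ler_pM; rewrite ?hnorm_ge0.
  have Gn : G (2 ^+ n) != 0 by rewrite gt_eqF ?G_gt0.
  by rewrite le_eqVlt; apply/orP; left; apply/eqP; rewrite /M; field.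
clearbody M.
have a0 n : 0 <= a n by rewrite mulr_ge0 ?hnorm_ge0.
have t1 : 0 < (1 : R) <= 1 by rewrite ltr01 lexx.
have domx : dom (real_function_of ip E G) x.
  pose I1 := \int[lebesgue_measure]_(s in `]0, 1]) (omega s / s).
  (* At [t = 1] every index satisfies the condition under the sum. *)
  have sI n : \sum_(i < n) omega (2 ^- i) <= 2 * c ^+ 2 * I1.
    have := dyadic_sum_le_dini omega_nondecr omega0 c0 dbl omega_dini n t1.
    congr (_ <= _); apply: eq_bigl => i; rewrite invf_le1// exprn_ege1//.
    by rewrite ler1n.
  apply: (real_function_dom_shells (K := a 0%N + M * (2 * c ^+ 2 * I1)) Hip pE mS tS SE mG g0 Gg).
  move=> [|n].
    rewrite big_ord0 addr_ge0// mulr_ge0 ?(ltW M0)//.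
    by have := sI 0%N; rewrite big_ord0.
  rewrite big_ord_recl lerD//.
  apply: le_trans (_ : M * \sum_(i < n) omega (2 ^- i) <= _); last by rewrite ler_pM2l.
  by rewrite mulr_sumr; apply: ler_sum => i _; exact: aM.
split => // k k0.
(* The strict inequality of the hypothesis at [r = 1], whose left side is nonnegative, forces
   positivity; [A1] divides by [omega 1]. *)
have om1 : 0 < omega 1.
  have := xm 1 ltr01; rewrite divr1.
  have := hnorm_tail_le_best_approx Hip linB HE x ltr01 (ltr1n R 2 : 1 < 2).
  move=> /(le_trans (hnorm_ge0 _)) /le_lt_trans /[apply].
  by rewrite pmulr_rgt0// divr_gt0 ?G_gt0.
(* [A1] collects shell 0 and the shells with [t <= 2^-(i+1)], where [4^k] comes from
   [t 2^(i+2) = 4 t 2^i]; [A2] collects the remaining shells. *)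
pose A1 := 2 ^+ k * a 0%N * (2 * c / omega 1) + 4 ^+ k * M * (2 * c).
pose A2 := 2 ^+ k * M * (2 * c ^+ 2).
have A1_ge0 : 0 <= A1.
  by rewrite addr_ge0// !mulr_ge0 ?exprn_ge0// ?invr_ge0 ?(ltW M0) ?(ltW c0) ?(ltW om1) ?hnorm_ge0.
have A2_gt0 : 0 < A2 by rewrite !mulr_gt0 ?exprn_gt0.
exists (A1 + A2) => [|t /andP[t_gt0 t_half]]; first by rewrite ltr_wpDl.
have t01 : 0 < t <= 1 by rewrite t_gt0/=; lra.
have sT n := dyadic_sum_le_tail_integral omega_nondecr omega0 c0 dbl k n t01.
have sD n := dyadic_sum_le_dini omega_nondecr omega0 c0 dbl omega_dini n t01.
set I1 := \int[lebesgue_measure]_(s in `[t, 1]) (omega s / s ^+ k.+1) in sT *.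
set I2 := \int[lebesgue_measure]_(s in `]0, t]) (omega s / s) in sD *.
(* The single term [i = 0] of the dyadic sum, admissible because [t <= 1/2]. *)
have I1_ge : omega 1 <= 2 * c * I1.
  have := sT 1%N; rewrite big_mkcond big_ord_recl big_ord0 /= addr0.
  by rewrite expr1 -div1r t_half mul0n !expr0 invr1 !mul1r.
have I1_ge0 : 0 <= I1.
  have : 0 < 2 * c * I1 by exact: lt_le_trans I1_ge.
  by rewrite pmulr_rgt0 ?mulr_gt0// => /ltW.
have I2_ge0 : 0 <= I2.
  have := sD 0%N; rewrite big_ord0 pmulr_rge0// mulr_gt0// exprn_gt0//.
apply: (@le_trans _ _ (A1 * (t ^+ k * I1) + A2 * I2)); last first.
  have tI : 0 <= t ^+ k * I1 by rewrite mulr_ge0// exprn_ge0// ltW.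
  rewrite mulrDr; apply: lerD; apply: ler_wpM2r => //.
    by rewrite lerDl ltW.
  by rewrite lerDr.
apply: ge_sup.
  by exists (hnorm (difference ip E t k (real_function_of ip E G x))), t => //=; rewrite t_gt0 lexx.
move=> _ [tau /= /andP[tau0 taut] <-].
set w := difference _ _ _ _ _.
have wS n b : 0 <= b -> (forall l, S n l -> Num.min 2 `|tau * l| <= b) ->
    hnorm (E (S n) w) <= b ^+ k * a n.
  move=> b0 hb; apply: le_trans (hnorm_difference_le Hip pE k _ (mS n) b0 hb) _.
  apply: ler_wpM2l; first exact: exprn_ge0.
  exact: (hnorm_real_function_le Hip pE mG domx (mS n) (g0 n) (Gg n)).
(* This bound, from [tau |l|], serves the low shells; the next one, from the constant 2, serves the
   high ones. *)
have w0 n : hnorm (E (S n) w) <= (t * 2 ^+ n.+1) ^+ k * a n.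
  apply: wS => [|l /spectral_shell_lt ln]; first by rewrite mulr_ge0 ?ltW.
  rewrite ge_min; apply/orP; right; rewrite normrM (gtr0_norm tau0).
  by apply: ler_pM => //; exact: ltW.
have w2 n : hnorm (E (S n) w) <= 2 ^+ k * a n.
  by apply: wS => // l _; rewrite ge_min lexx.
apply: (hnorm_le_shells pE mS tS SE) => n.
pose f1 i := t ^+ k * 4 ^+ k * M * (2 ^+ (i * k) * omega (2 ^- i)).
pose f2 i := 2 ^+ k * M * omega (2 ^- i).
have om i : 0 <= omega (2 ^- i) by rewrite om0// invr_ge0 ltW.
have f10 i : 0 <= f1 i by rewrite !mulr_ge0 ?exprn_ge0 ?(ltW M0) ?(ltW t_gt0).
have f20 i : 0 <= f2 i by rewrite !mulr_ge0 ?exprn_ge0 ?(ltW M0).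
(* At [t = 2^-(i+1)] both conditions hold, as in the two dyadic sums; the extra term is
   nonnegative. *)
have term i : hnorm (E (S i.+1) w) <=
    (if t <= 2 ^- i.+1 then f1 i else 0) + (if 2 ^- i.+1 <= t then f2 i else 0).
  have [ti|ti] := leP t (2 ^- i.+1).
    apply: (@le_trans _ _ (f1 i)); last by rewrite lerDl; case: ifP.
    apply: le_trans (w0 i.+1) _.
    have -> : f1 i = (t * 2 ^+ i.+2) ^+ k * (M * omega (2 ^- i)).
      have -> : 2 ^+ i.+2 = 4 * 2 ^+ i :> R by rewrite !exprS mulrA -natrM.
      by rewrite /f1 !exprMn exprM; ring.
    by apply: ler_wpM2l => //; rewrite exprn_ge0// mulr_ge0 ?ltW.
  rewrite (ltW ti) add0r /f2 -mulrA; apply: le_trans (w2 _) _.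
  by rewrite ler_pM2l ?exprn_gt0.
(* Shell 0 carries no factor of [omega]; inserting [2 c I1 / omega 1 >= 1] brings in the
   integral. *)
have first_le : hnorm (E (S 0%N) w) <= 2 ^+ k * a 0%N * (2 * c / omega 1) * (t ^+ k * I1).
  apply: le_trans (w0 0%N) _; rewrite expr1 exprMn.
  have -> : 2 ^+ k * a 0%N * (2 * c / omega 1) * (t ^+ k * I1) =
      t ^+ k * 2 ^+ k * a 0%N * (2 * c * I1 / omega 1).
    by field; rewrite gt_eqF.
  rewrite ler_peMr//; last by rewrite ler_pdivlMr// mul1r.
  by rewrite !mulr_ge0 ?exprn_ge0 ?(ltW t_gt0) ?hnorm_ge0.
have tI : 0 <= t ^+ k * I1 by rewrite mulr_ge0 ?exprn_ge0 ?(ltW t_gt0).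
case: n => [|n]; first by rewrite big_ord0 addr_ge0// mulr_ge0// ltW.
rewrite big_ord_recl /A1 mulrDl -addrA; apply: lerD => //.
apply: (@le_trans _ _ (\sum_(i < n) ((if t <= 2 ^- i.+1 then f1 i else 0) +
     (if 2 ^- i.+1 <= t then f2 i else 0)))).
  by apply: ler_sum => i _; exact: term.
rewrite big_split /= -!big_mkcond -!mulr_sumr; apply: lerD.
  have -> : 4 ^+ k * M * (2 * c) * (t ^+ k * I1) = t ^+ k * 4 ^+ k * M * (2 * c * I1) by ring.
  by apply: ler_wpM2l; rewrite ?sT// !mulr_ge0 ?exprn_ge0 ?(ltW M0) ?(ltW t_gt0).
rewrite /A2 -[_ * (2 * c ^+ 2) * I2]mulrA.
by apply: ler_wpM2l; rewrite ?sD// mulr_ge0 ?exprn_ge0 ?(ltW M0).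
Qed.
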